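(* Let $T>0$, let $U\subset\mathbb{R}^2$ be an open bounded set with $0_{\mathbb{R}^2}\in U$, and let $\phi\colon[0,T]\times\overline U\to\mathbb{R}^2$ be a continuous map with $\phi(0,x)=x$ for all $x\in\overline U$ and such that $0_{\mathbb{R}^2}\notin\phi([0,T]\times\partial U)$. Let $f_T\colon\overline U\to\mathbb{R}^2$, $f_T(x)=\phi(T,x)-x$, and let $F_T\colon\Psi^{-1}(\partial U)\to\mathbb{R}^2$, $F_T(y)=\Phi(T,y)-y$, where $\Phi$ is the continuous lift of $\phi$ restricted to $[0,T]\times\partial U$. If $\Sigma(F_T,\partial U)=\emptyset$, then $\deg(f_T,U,0)=1$, and thus $\phi(T,\cdot)$ has a fixed point in $U$.
   Context: $\deg(g,U,v)$ denotes Brouwer's degree of a continuous map $g\colon\overline U\to\mathbb{R}^2$ on the open bounded set $U\subset\mathbb{R}^2$ with respect to $v\notin g(\partial U)$. Polar-like coordinates. Let $\mathscr{H}=\mathbb{R}\times(0,+\infty)$ and $\overline{\mathscr{H}}=\mathbb{R}\times[0,+\infty)$. A map $\Psi\colon\overline{\mathscr{H}}\to\mathbb{R}^2$ is fixed such that: $\Psi(\vartheta,r)$ is $2\pi$-periodic in $\vartheta$; $\Psi^{-1}(0_{\mathbb{R}^2})=\mathbb{R}\times\{0\}$; $\Psi$ is continuous and its restriction to $\mathscr{H}$ is a local homeomorphism; $\Psi$ is a bijection between $[0,2\pi)\times(0,+\infty)$ and $\mathbb{R}^2\setminus\{0_{\mathbb{R}^2}\}$; $\Psi$ is orientation preserving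 (e.g. clockwise polar coordinates $\Psi(\vartheta,r)=(r\cos\vartheta,-r\sin\vartheta)$). Lift. If $\phi$ is continuous, $\phi(0,\cdot)$ is the identity, and $E$ is a set with $0_{\mathbb{R}^2}\notin\phi([0,T]\times E)$, then $\Phi\colon[0,T]\times\Psi^{-1}(E)\to\mathscr{H}$ denotes the unique continuous map with $\Phi(0,\cdot)$ the identity and $\Psi(\Phi(t,y))=\phi(t,\Psi(y))$ for all $t\in[0,T]$, $y\in\Psi^{-1}(E)$. It satisfies $\Phi(t,(\vartheta+2\pi,r))=\Phi(t,(\vartheta,r))+(2\pi,0)$, so $F_T(y)=\Phi(T,y)-y$ is $2\pi$-periodic in $\vartheta$. Rotation. For a continuous $F=(F^\vartheta,F^r)\colon\Psi^{-1}(E)\to\mathbb{R}^2$, $2\pi$-periodic in $\vartheta$, with $0_{\mathbb{R}^2}\notin E$, and $x\in E$, set $\mathrm{rot}(F,x)=\frac{1}{2\pi}F^\vartheta(y)$ for any $y\in\Psi^{-1}(x)$, $\mathrm{rot}(F,E)=\{\mathrm{rot}(F,x):x\in E\}$, and $\Sigma(F,E)=\mathbb{Z}\cap\mathrm{conv}\,\mathrm{rot}(F,E)$, with $\mathrm{conv}$ the convex hull. *)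

(* Defs.v *)
(* The plane R^2 is the normed module R * R, for R a realType. *)
From HB Require Import structures.
From mathcomp Require Import all_boot all_order all_algebra.
From mathcomp Require Import all_classical all_reals all_analysis.

Set Implicit Arguments.
Unset Strict Implicit.
Unset Printing Implicit Defensive.

Import Order.TTheory GRing.Theory Num.Theory numFieldNormedType.Exports.

Local Open Scope classical_set_scope.
Local Open Scope ring_scope.

Definition boundary (T : topologicalType) (A : set T) : set T :=
  closure A `\` interior A.

Definition convex_hull (R : realType) (A : set R) : set R :=
  smallest (@convex_set R R^o) A.

(* ** Brouwer degree in the plane

   The classical analytic definition.  For h continuous on the closure of U,
   C^1 in U, and v a regular value of h outside h(boundary U), the degree is
   the sum of the signs of the Jacobian determinant over the preimages of v in
   U.  For g merely continuous, it is the common value of these sums over all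
   such h with sup_(closure U) |h - g| < dist (v, g(boundary U)).  It is only
   meaningful for U open and bounded, g continuous on the closure of U and v
   not in g(boundary U). *)

Definition jacobian_det (R : realType) (h : R * R -> R * R) (x : R * R) : R :=
  ('D_(1, 0) h x).1 * ('D_(0, 1) h x).2
  - ('D_(0, 1) h x).1 * ('D_(1, 0) h x).2.

Definition C1_on (R : realType) (U : set (R * R)) (h : R * R -> R * R) : Prop :=
  forall x, U x ->
    differentiable h x /\
    forall v : R * R, {for x, continuous (fun z => 'D_v h z)}.

Definition regular_value (R : realType) (U : set (R * R))
    (h : R * R -> R * R) (v : R * R) : Prop :=
  forall x, U x -> h x = v -> jacobian_det h x != 0.

(* The last clause is the comparison with the distance to g(boundary U): as the
   closure and the boundary of U are compact, the extrema are attained.  It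
   forces v not to be in h(boundary U).  The norm on R * R is the max norm; the
   degree does not depend on this choice. *)
Definition regular_approx (R : realType) (g : R * R -> R * R)
    (U : set (R * R)) (v : R * R) (h : R * R -> R * R) : Prop :=
  [/\ {within closure U, continuous h},
      C1_on U h,
      regular_value U h v &
      forall x z, closure U x -> boundary U z -> `|h x - g x| < `|g z - v|].

(* The index set is finite whenever h is a regular approximation. *)
Definition regular_degree (R : realType) (h : R * R -> R * R)
    (U : set (R * R)) (v : R * R) : int :=
  \sum_(x \in U `&` h @^-1` [set v]) sgz (jacobian_det h x).

Definition brouwer_degree (R : realType) (g : R * R -> R * R)
    (U : set (R * R)) (v : R * R) : int :=
  xget 0 [set d | (exists h, regular_approx g U v h) /\
                  forall h, regular_approx g U v h -> regular_degree h U v = d].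

(* ** Polar-like coordinates

   Points of the half-plane are pairs (theta, r).  Maps on the closed
   half-plane are represented by total functions whose values for r < 0 are
   irrelevant. *)

Definition half_plane (R : realType) : set (R * R) := [set y | 0 < y.2].

Definition closed_half_plane (R : realType) : set (R * R) :=
  [set y | 0 <= y.2].

Arguments half_plane : clear implicits.
Arguments closed_half_plane : clear implicits.

Definition local_homeomorphism_on (R : realType) (D : set (R * R))
    (f : R * R -> R * R) : Prop :=
  forall y, D y -> exists (V : set (R * R)) (g : R * R -> R * R),
    [/\ open V, V y & V `<=` D] /\
    [/\ {within V, continuous f}, open (f @` V),
        (forall z, V z -> g (f z) = z) & {within f @` V, continuous g}].

(* A local homeomorphism preserves orientation when its local degree at each
   point, i.e. its degree on any small enough ball around it, is 1. *)
Definition orientation_preserving_on (R : realType) (D : set (R * R))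
    (f : R * R -> R * R) : Prop :=
  forall y, D y -> \forall e \near 0^'+, brouwer_degree f (ball y e) (f y) = 1.

Record polar_like (R : realType) (Psi : R * R -> R * R) : Prop := PolarLike {
  polar_periodic : forall theta r, 0 <= r ->
    Psi (theta + 2 * pi, r) = Psi (theta, r) ;
  polar_zero : forall y, closed_half_plane R y -> (Psi y = 0 <-> y.2 = 0) ;
  polar_continuous : {within closed_half_plane R, continuous Psi} ;
  polar_local_homeo : local_homeomorphism_on (half_plane R) Psi ;
  polar_bij : set_bij [set y | 0 <= y.1 < 2 * pi /\ 0 < y.2] (~` [set 0]) Psi ;
  polar_orientation : orientation_preserving_on (half_plane R) Psi
}.

Definition polar_preimage (R : realType) (Psi : R * R -> R * R)
    (E : set (R * R)) : set (R * R) :=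
  closed_half_plane R `&` Psi @^-1` E.

Definition is_lift (R : realType) (Psi : R * R -> R * R) (T : R)
    (E : set (R * R)) (phi Phi : R -> R * R -> R * R) : Prop :=
  [/\ {within `[0, T] `*` polar_preimage Psi E,
         continuous (fun p : R * (R * R) => Phi p.1 p.2)},
      (forall t y, 0 <= t <= T -> polar_preimage Psi E y ->
         half_plane R (Phi t y)),
      (forall y, polar_preimage Psi E y -> Phi 0 y = y) &
      (forall t y, 0 <= t <= T -> polar_preimage Psi E y ->
         Psi (Phi t y) = phi t (Psi y))].

(* [get] picks some y above x; for F periodic in theta the value does not
   depend on y. *)
Definition rot (R : realType) (Psi F : R * R -> R * R) (x : R * R) : R :=
  (F (get (polar_preimage Psi [set x]))).1 / (2 * pi).

Definition rot_set (R : realType) (Psi F : R * R -> R * R)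
    (E : set (R * R)) : set R := rot Psi F @` E.

Definition Sigma (R : realType) (Psi F : R * R -> R * R)
    (E : set (R * R)) : set int :=
  [set k | convex_hull (rot_set Psi F E) k%:~R].

(* Main.v *)
Require Import Defs.
From HB Require Import structures.
From mathcomp Require Import all_boot all_order all_algebra.
From mathcomp Require Import all_classical all_reals all_analysis.
From mathcomp Require Import ring lra.

Set Implicit Arguments.
Unset Strict Implicit.
Unset Printing Implicit Defensive.

Import Order.TTheory GRing.Theory Num.Theory numFieldNormedType.Exports.

Local Open Scope classical_set_scope.
Local Open Scope ring_scope.

(** Why the theorem is true.  Let [x] be a point of the boundary of [U], at
    [y = (theta, r)] in polar-like coordinates, and let [(theta', r')] be the
    lift [Phi T y] of [phi T x].  If [Sigma] is empty, then [theta' - theta] is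
    not a multiple of [2 * pi].  So, for [l] in the unit interval, the point at
    [(theta', l * r')] differs from [x]: when [l] decreases from [1] to [0],
    the map [phi T x - x] is deformed into [- x] on the boundary of [U] without
    vanishing.  Since [-1] is an exponential, [phi T x - x] is then [x] times
    the exponential of a continuous complex function ([log_sub_id]).

    It remains to see that such a boundary behaviour forces the degree to be
    [1].  The plane is identified with the complex numbers.  The tool, in place
    of a general theory of the degree, is the existence of continuous
    logarithms along nonvanishing homotopies on compact sets ([homotopy_log]);
    it gives winding numbers on circles and a topological argument principle
    ([winds_sum_sign]): if a continuous map of the plane has finitely many
    zeros, all inside a circle, and behaves near each zero [a] like a multiple
    of [x - a] or of its conjugate, then its winding number along the circle is
    the number of zeros counted with signs.

    Let [h] be a regular approximation of [phi T x - x].  On the boundary, [h]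
    is also [x] times the exponential of a continuous function ([log_close]).
    This function extends to the plane by Tietze's theorem, so [h] extends from
    the closure of [U] to a continuous map of the plane that, outside [U], is
    [x] times an exponential.  This extension has no zero outside [U], and its
    winding number along large circles is [1].  Hence the signs of the Jacobian
    determinant of [h] at its zeros add up to [1] ([regular_degree_boundary]).
    The same argument without zeros is absurd, which gives the fixed point
    ([zero_boundary]).

    The degree is defined through regular approximations, so one has to be
    constructed ([smooth_regular_map]).  The values of the map at the points of
    a fine grid are interpolated in each cell by a bilinear map of smooth steps
    in each coordinate.  The critical values of a bilinear map, as well as its
    values on the sides of the cell, lie on finitely many curves with quadratic
    parametrisations, and a small vector outside all of these curves
    ([avoid_qcurves]) is a regular value. *)

(** * The plane as the field of complex numbers *)

Section ComplexPlane.
Variable R : realType.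
Implicit Types (z w u v : R * R).

(** The points of the plane are read as complex numbers: the first coordinate is
    the real part and the second one the imaginary part.  The ring product
    of [R * R] is componentwise and is not used. *)

(** The complex unit; it differs from the unit [(1, 1)] of the product ring. *)
Definition cone : R * R := (1, 0).

Definition cmul z w : R * R :=
  (z.1 * w.1 - z.2 * w.2, z.1 * w.2 + z.2 * w.1).

Definition cconj z : R * R := (z.1, - z.2).

(** Squared modulus. *)
Definition csqn z : R := z.1 ^+ 2 + z.2 ^+ 2.

(** Euclidean modulus, as opposed to the norm [`|z|], which is the maximum
    norm. *)
Definition cmod z : R := Num.sqrt (csqn z).

(** Complex inverse, with value [0] at [0]. *)
Definition cinv z : R * R := (z.1 / csqn z, - z.2 / csqn z).

(** Complex exponential. *)
Definition cexp u : R * R := (expR u.1 * cos u.2, expR u.1 * sin u.2).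

(** Principal logarithm; the formula is only meaningful in the open right
    half-plane. *)
Definition clog z : R * R := (ln (cmod z), atan (z.2 / z.1)).

Lemma pairE (x y : R * R) : x.1 = y.1 -> x.2 = y.2 -> x = y.
Proof. by case: x y => [? ?] [? ?] /= -> ->. Qed.

Lemma cmulC z w : cmul z w = cmul w z.
Proof. by apply: pairE => /=; ring. Qed.

Lemma cmulA z w v : cmul z (cmul w v) = cmul (cmul z w) v.
Proof. by apply: pairE => /=; ring. Qed.

Lemma cmul1 z : cmul z cone = z.
Proof. by apply: pairE => /=; ring. Qed.

Lemma cmul0 z : cmul z 0 = 0.
Proof. by apply: pairE => /=; ring. Qed.

Lemma cmulBl z w v : cmul (z - w) v = cmul z v - cmul w v.
Proof. by apply: pairE => /=; ring. Qed.

Lemma csqn_ge0 z : 0 <= csqn z.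
Proof. by rewrite addr_ge0 ?sqr_ge0. Qed.

Lemma csqn_eq0 z : (csqn z == 0) = (z == 0).
Proof.
by rewrite paddr_eq0 ?sqr_ge0// !sqrf_eq0; case: z.
Qed.

Lemma csqn_gt0 z : (0 < csqn z) = (z != 0).
Proof. by rewrite lt_neqAle csqn_ge0 andbT eq_sym csqn_eq0. Qed.

Lemma csqnM z w : csqn (cmul z w) = csqn z * csqn w.
Proof. by rewrite /csqn /=; ring. Qed.

Lemma cmul_neq0 z w : z != 0 -> w != 0 -> cmul z w != 0.
Proof. by rewrite -!csqn_gt0 csqnM; exact: mulr_gt0. Qed.

Lemma cmulV z : z != 0 -> cmul z (cinv z) = cone.
Proof.
rewrite -csqn_gt0 => /lt0r_neq0; rewrite /cmul /cinv /cone /csqn /= => z0.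
by apply: pairE => /=; field.
Qed.

Lemma cinv_neq0 z : z != 0 -> cinv z != 0.
Proof.
move=> z0; apply/eqP => e; have := cmulV z0; rewrite e cmul0 => -[/esym/eqP].
by rewrite oner_eq0.
Qed.

Lemma cmulVK z w : w != 0 -> cmul (cmul z (cinv w)) w = z.
Proof. by move=> w0; rewrite -cmulA (cmulC _ w) cmulV// cmul1. Qed.

Lemma csqnJ z : csqn (cconj z) = csqn z.
Proof. by rewrite /csqn /= sqrrN. Qed.

Lemma cmod_ge0 z : 0 <= cmod z.
Proof. exact: sqrtr_ge0. Qed.

Lemma cmodJ z : cmod (cconj z) = cmod z.
Proof. by rewrite /cmod csqnJ. Qed.

Lemma sqr_cmod z : cmod z ^+ 2 = csqn z.
Proof. by rewrite sqr_sqrtr ?csqn_ge0. Qed.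

Lemma cmodM z w : cmod (cmul z w) = cmod z * cmod w.
Proof. by rewrite /cmod csqnM sqrtrM ?csqn_ge0. Qed.

Lemma cmod_gt0 z : (0 < cmod z) = (z != 0).
Proof. by rewrite sqrtr_gt0 csqn_gt0. Qed.

Lemma cmod_eq0 z : (cmod z == 0) = (z == 0).
Proof. by apply: negb_inj; rewrite -cmod_gt0 lt_neqAle cmod_ge0 andbT eq_sym. Qed.

Lemma cmod0 : cmod 0 = 0.
Proof. by apply/eqP; rewrite cmod_eq0. Qed.

Lemma cmodN z : cmod (- z) = cmod z.
Proof. by rewrite /cmod /csqn /= !sqrrN. Qed.

Lemma cmodV z : z != 0 -> cmod (cinv z) = (cmod z)^-1.
Proof.
move=> z0; have c0 : cmod z != 0 by rewrite cmod_eq0.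
apply: (mulfI c0); rewrite -cmodM cmulV// mulfV//.
by rewrite /cmod /csqn /= expr1n expr0n /= addr0 sqrtr1.
Qed.

Lemma normr1_le_cmod z : `|z.1| <= cmod z.
Proof. by rewrite -sqrtr_sqr ler_wsqrtr// lerDl sqr_ge0. Qed.

Lemma normr2_le_cmod z : `|z.2| <= cmod z.
Proof. by rewrite -sqrtr_sqr ler_wsqrtr// lerDr sqr_ge0. Qed.

Lemma norm_le_cmod z : `|z| <= cmod z.
Proof. by rewrite prod_normE ge_max normr1_le_cmod normr2_le_cmod. Qed.

Lemma cmod_le_norm z : cmod z <= 2 * `|z|.
Proof.
have h1 : `|z.1| <= `|z| by rewrite prod_normE le_max lexx.
have h2 : `|z.2| <= `|z| by rewrite prod_normE le_max lexx orbT.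
rewrite -(ler_pXn2r (n:=2)) ?nnegrE ?cmod_ge0 ?mulr_ge0// sqr_cmod /csqn.
rewrite -(real_normK (num_real z.1)) -(real_normK (num_real z.2)).
have := normr_ge0 z.1; have := normr_ge0 z.2; nra.
Qed.

Lemma Re_le_cmod z w : z.1 * w.1 + z.2 * w.2 <= cmod z * cmod w.
Proof.
apply: (le_trans (ler_norm _)); rewrite -sqrtr_sqr -sqrtrM ?csqn_ge0//.
rewrite ler_wsqrtr// /csqn.
have := sqr_ge0 (z.1 * w.2 - z.2 * w.1); nra.
Qed.

Lemma cmodD z w : cmod (z + w) <= cmod z + cmod w.
Proof.
rewrite -(ler_pXn2r (n:=2)) ?nnegrE ?addr_ge0 ?cmod_ge0//.
rewrite sqrrD !sqr_cmod /csqn /=.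
have := Re_le_cmod z w; nra.
Qed.

Lemma cexpD u v : cexp (u + v) = cmul (cexp u) (cexp v).
Proof. by apply: pairE => /=; rewrite expRD ?cosD ?sinD; ring. Qed.

Lemma cexp0 : cexp 0 = cone.
Proof. by apply: pairE; rewrite /= expR0 ?cos0 ?sin0; ring. Qed.

Lemma cmod_cexp u : cmod (cexp u) = expR u.1.
Proof.
rewrite /cmod /csqn /= !exprMn -mulrDr cos2Dsin2 mulr1 sqrtr_sqr ger0_norm//.
Qed.

Lemma cexp_neq0 u : cexp u != 0.
Proof. by rewrite -cmod_gt0 cmod_cexp expR_gt0. Qed.

Lemma cexpJ u : cconj (cexp u) = cexp (cconj u).
Proof. by apply: pairE => //=; rewrite ?cosN ?sinN ?mulrN. Qed.

Lemma cexp_clog z : 0 < z.1 -> cexp (clog z) = z.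
Proof.
move=> z1; have z0 : z != 0 by apply: contraTN z1 => /eqP ->; rewrite /= ltxx.
have ct : cos (atan (z.2 / z.1)) = z.1 / cmod z.
  rewrite cos_atan; apply: invr_inj; rewrite invrK invf_div.
  have -> : 1 + (z.2 / z.1) ^+ 2 = csqn z / z.1 ^+ 2.
    by rewrite /csqn; field; exact: lt0r_neq0.
  by rewrite sqrtrM ?csqn_ge0// sqrtrV ?sqr_ge0// sqrtr_sqr gtr0_norm.
have cp : 0 < cmod z by rewrite cmod_gt0.
have st : sin (atan (z.2 / z.1)) = z.2 / cmod z.
  have /(_ (z.2 / z.1)) := @atanK R; rewrite /tan ct => h.
  have : sin (atan (z.2 / z.1)) = (z.2 / z.1) * (z.1 / cmod z).
    by rewrite -[X in _ = X * _]h; field; rewrite !lt0r_neq0.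
  by move=> ->; field; rewrite !lt0r_neq0.
by apply: pairE; rewrite /= lnK ?posrE// ?ct ?st; field; rewrite lt0r_neq0.
Qed.

Lemma cexp_pi : cexp (0, pi) = (-1, 0).
Proof. by rewrite /cexp /= expR0 !mul1r cospi sinpi. Qed.

Lemma cexp_surj z : z != 0 -> exists u, z = cexp u.
Proof.
move=> z0; case: (ltrgtP 0 z.1) => z1; first by exists (clog z); rewrite cexp_clog.
- exists (clog (- z) + (0, pi)); rewrite cexpD cexp_clog ?oppr_gt0//.
  by rewrite cexp_pi; apply: pairE => /=; ring.
- have z2 : z.2 != 0.
    by apply: contraNN z0 => /eqP z2; apply/eqP/pairE; rewrite ?z1.
  pose i : R * R := (0, 1).
  case: (ltrgtP 0 z.2) z2 => // z2 _.
  + exists (clog (z.2, 0) + (0, pi / 2)); rewrite cexpD cexp_clog//.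
    rewrite /cexp /= cos_pihalf sin_pihalf expR0.
    by apply: pairE => /=; rewrite -?z1; ring.
  + exists (clog (- z.2, 0) + (0, - (pi / 2))); rewrite cexpD cexp_clog ?oppr_gt0//.
    rewrite /cexp /= cosN sinN cos_pihalf sin_pihalf expR0.
    by apply: pairE => /=; rewrite -?z1; ring.
Qed.

End ComplexPlane.

Section ComplexContinuity.
Variables (R : realType) (I : Type) (F : set_system I).
Context {FF : Filter F}.
Implicit Types f g : I -> R * R.

Let fst_cont (l : R * R) : {for l, continuous (@fst R R)}.
Proof. by move=> A; exact: (@cvg_fst R R (nbhs l.1) (nbhs l.2)). Qed.

Let snd_cont (l : R * R) : {for l, continuous (@snd R R)}.
Proof. by move=> A; exact: (@cvg_snd R R (nbhs l.1) (nbhs l.2)). Qed.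

Lemma cvg_pairP f (l : R * R) :
  f x @[x --> F] --> l <->
  ((f x).1 @[x --> F] --> l.1) /\ ((f x).2 @[x --> F] --> l.2).
Proof.
split=> [fl|[f1 f2]].
- split; first exact: (continuous_cvg _ (@fst_cont l) fl).
  exact: (continuous_cvg _ (@snd_cont l) fl).
- have -> : f = fun x => ((f x).1, (f x).2) by apply/funext => x; case: (f x).
  by case: l f1 f2 => a b /= f1 f2; apply: (cvg_pair f1 f2).
Qed.

Lemma cvg_cmul f g (a b : R * R) : f x @[x --> F] --> a -> g x @[x --> F] --> b ->
  cmul (f x) (g x) @[x --> F] --> cmul a b.
Proof.
move=> /cvg_pairP[fa1 fa2] /cvg_pairP[gb1 gb2]; apply/cvg_pairP; split => /=.
- by apply: cvgB; apply: cvgM.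
- by apply: cvgD; apply: cvgM.
Qed.

Lemma cvg_cconj f (a : R * R) : f x @[x --> F] --> a ->
  cconj (f x) @[x --> F] --> cconj a.
Proof.
by move=> /cvg_pairP[fa1 fa2]; apply/cvg_pairP; split => //=; exact: cvgN.
Qed.

Lemma cvg_csqn f (a : R * R) : f x @[x --> F] --> a ->
  csqn (f x) @[x --> F] --> csqn a.
Proof.
move=> /cvg_pairP[fa1 fa2]; rewrite /csqn; apply: cvgD;
  under eq_fun do rewrite expr2; rewrite expr2; exact: cvgM.
Qed.

Lemma cvg_cmod f (a : R * R) : f x @[x --> F] --> a ->
  cmod (f x) @[x --> F] --> cmod a.
Proof.
by move=> /cvg_csqn fa; exact: (continuous_cvg _ (@sqrt_continuous R _) fa).
Qed.

Lemma cvg_cinv f (a : R * R) : a != 0 -> f x @[x --> F] --> a ->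
  cinv (f x) @[x --> F] --> cinv a.
Proof.
move=> a0 fa; move: (fa) => /cvg_pairP[fa1 fa2].
have iv : (csqn (f x))^-1 @[x --> F] --> (csqn a)^-1.
  by apply: cvgV; [rewrite csqn_eq0|exact: cvg_csqn].
apply/cvg_pairP; split => /=; apply: cvgM => //; exact: cvgN.
Qed.

Lemma cvg_cexp f (a : R * R) : f x @[x --> F] --> a ->
  cexp (f x) @[x --> F] --> cexp a.
Proof.
move=> /cvg_pairP[fa1 fa2].
have e1 := continuous_cvg _ (@continuous_expR R _) fa1.
apply/cvg_pairP; split => /=; (apply: cvgM; first exact: e1).
- exact: (continuous_cvg _ (@continuous_cos R _) fa2).
- exact: (continuous_cvg _ (@continuous_sin R _) fa2).
Qed.

Lemma cvg_clog f (a : R * R) : 0 < a.1 -> f x @[x --> F] --> a ->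
  clog (f x) @[x --> F] --> clog a.
Proof.
move=> a1 fa; move: (fa) => /cvg_pairP[fa1 fa2].
have a0 : a != 0 by apply: contraTN a1 => /eqP ->; rewrite /= ltxx.
apply/cvg_pairP; split => /=.
- have c0 : 0 < cmod a by rewrite cmod_gt0.
  exact: (continuous_cvg _ (continuous_ln c0) (cvg_cmod fa)).
- apply: (continuous_cvg _ (@continuous_atan R _)).
  by apply: cvgM => //; apply: cvgV => //; exact: lt0r_neq0.
Qed.

End ComplexContinuity.

(** * Continuous logarithms along homotopies *)

Lemma within_slice (X Y Z : topologicalType) (B : set X) (A : set Y)
    (f : X -> Y -> Z) (t : X) : B t ->
  {within B `*` A, continuous (fun p : X * Y => f p.1 p.2)} ->
  {within A, continuous (f t)}.
Proof.
move=> Bt cf; apply/subspace_continuousP => x Ax W /= WK.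
have /= := (subspace_continuousP _ _).1 cf (t, x) (conj Bt Ax) W WK.
move=> [[U V] /= [Ut Vx] UV]; rewrite /within /=.
change (nbhs x (fun y => A y -> W (f t y))).
apply: filterS Vx => y Vy Ay.
by apply: (UV (t, y)); split => //=; exact: nbhs_singleton Ut.
Qed.

Section HomotopyLogarithm.
Variables (R : realType) (X : topologicalType) (A : set X).
Variable K : R -> X -> R * R.
Implicit Types t s r : R.
Hypothesis A_compact : compact A.
Hypothesis K_continuous :
  {within `[0, 1] `*` A, continuous (fun p : R * X => K p.1 p.2)}.
Hypothesis K_neq0 : forall t x, 0 <= t <= 1 -> A x -> K t x != 0.

(** [K t] and [K s] differ on [A] by the exponential of a continuous map. *)
Definition log_related (t s : R) : Prop :=
  exists u : X -> R * R, {within A, continuous u} /\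
    forall x, A x -> K t x = cmul (cexp (u x)) (K s x).

Lemma slice_continuous t : 0 <= t <= 1 -> {within A, continuous (K t)}.
Proof. by move=> t01; apply: within_slice K_continuous; rewrite /= in_itv. Qed.

(** By compactness of [A], the quotient of [K t] by [K s] stays close to [1],
    uniformly on [A], for [t] close to [s]. *)
Lemma ratio_right_half_plane (s : R) : 0 <= s <= 1 ->
  \forall t \near s, 0 <= t <= 1 ->
    forall x, A x -> 0 < (cmul (K t x) (cinv (K s x))).1.
Proof.
move=> s01.
pose P (t : R) x := 0 <= t <= 1 -> 0 < (cmul (K t x) (cinv (K s x))).1.
suff : \near s, A `<=` P s.
  by apply: filterS => t AP t01 x Ax; exact: AP.
have ncA := (near_covering_withinP A).2 ((compact_near_coveringP A).1 A_compact).
apply: (ncA R (nbhs s) P).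
move=> x Ax; pose B := `[(0:R), 1] `*` A.
have Bsx : B (s, x) by split; rewrite //= in_itv.
pose F := within B (nbhs (s, x)).
have cK : K p.1 p.2 @[p --> F] --> K s x.
  exact: (subspace_continuousP _ _).1 K_continuous (s, x) Bsx.
have cKs : K s p.2 @[p --> F] --> K s x.
  move=> W WK.
  have /(_ W WK) /= := (subspace_continuousP _ _).1 (slice_continuous s01) x Ax.
  rewrite /within /= => N; exists (setT, [set y | A y -> W (K s y)]).
    by split => //=; exact: filterT.
  by move=> [t y] /= [_ AW] [_ Ay]; exact: AW.
have r1 : cmul (K p.1 p.2) (cinv (K s p.2)) @[p --> F] --> cone R.
  rewrite -(cmulV (K_neq0 s01 Ax)).
  by apply: cvg_cmul => //; apply: cvg_cinv => //; exact: K_neq0.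
have [r11 _] := (cvg_pairP _ _).1 r1.
have : \forall p \near F, 0 < (cmul (K p.1 p.2) (cinv (K s p.2))).1.
  by apply: (cvgr_gt (cone R).1) => //=; exact: ltr01.
rewrite /F /within /= => -[[U V] /= [Us Vx] UV].
exists (V, U) => // -[y t] /= [Vy Ut] Ay t01.
by apply: (UV (t, y)) => //; split; rewrite //= in_itv.
Qed.

Lemma log_related_ratio t s : 0 <= t <= 1 -> 0 <= s <= 1 ->
  (forall x, A x -> 0 < (cmul (K t x) (cinv (K s x))).1) -> log_related t s.
Proof.
move=> t01 s01 ts; exists (fun x => clog (cmul (K t x) (cinv (K s x)))); split.
- apply/subspace_continuousP => x Ax; apply: cvg_clog; first exact: ts.
  apply: cvg_cmul.
    exact: (subspace_continuousP _ _).1 (slice_continuous t01) x Ax.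
  apply: cvg_cinv; first exact: K_neq0.
  exact: (subspace_continuousP _ _).1 (slice_continuous s01) x Ax.
- by move=> x Ax; rewrite cexp_clog ?ts// cmulVK//; exact: K_neq0.
Qed.

Lemma log_related_sym t s : log_related t s -> log_related s t.
Proof.
move=> [u [cu ue]]; exists (fun x => - u x); split.
  by move=> x; apply: cvgN; exact: cu.
move=> x Ax; rewrite ue// cmulA -cexpD addNr cexp0.
by rewrite cmulC cmul1.
Qed.

Lemma log_related_trans r s t :
  log_related r s -> log_related s t -> log_related r t.
Proof.
move=> [u [cu ue]] [v [cv ve]]; exists (fun x => u x + v x); split.
  by move=> x; apply: cvgD; [exact: cu|exact: cv].
by move=> x Ax; rewrite ue// ve// cmulA -cexpD.
Qed.

(** The times related to [0] form a nonempty clopen subset of the unit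
    interval. *)
Lemma homotopy_log : log_related 1 0.
Proof.
have K01 : 0 <= (0:R) <= 1 by rewrite lexx ler01.
pose S := [set t | 0 <= t <= 1 /\ log_related t 0].
suff SE : S = `[0, 1]%classic.
  by have : S 1 by [rewrite SE /= in_itv /= ler01 lexx]; case.
apply: (@segment_connected R 0 1).
- exists 0; split => //; apply: log_related_ratio => // x Ax.
  by rewrite cmulV ?K_neq0//; exact: ltr01.
- exists (interior [set t | 0 <= t <= 1 -> S t]); first exact: open_interior.
  rewrite eqEsubset; split => t.
  + move=> [t01 tl]; split; first by rewrite /= in_itv.
    apply: filterS (ratio_right_half_plane t01) => s st s01; split => //.
    by apply: log_related_trans tl; apply: log_related_ratio => //; exact: st.
  + by rewrite /= in_itv /= => -[t01 /nbhs_singleton]; exact.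
- exists (closure S); first exact: closed_closure.
  rewrite eqEsubset; split => t.
  + move=> St; split; last exact: subset_closure.
    by rewrite /= in_itv; case: St.
  + rewrite /= in_itv /= => -[t01 /(_ _ (ratio_right_half_plane t01))].
    move=> [s [[s01 sl] /(_ s01) st]]; split => //.
    apply: log_related_trans sl; apply: log_related_sym.
    by apply: log_related_ratio => //; exact: st.
Qed.

End HomotopyLogarithm.

(** * Winding numbers around centred circles *)

Section Winding.
Variable R : realType.
Implicit Types (F G : R * R -> R * R) (r : R) (n m : int) (t : R).

Lemma compact_plane (A : set (R * R)) (M : R) :
  closed A -> (forall x, A x -> `|x| <= M) -> compact A.
Proof.
move=> cA AM; apply: (subclosed_compact cA
  (compact_setX (@segment_compact R (- M) M) (@segment_compact R (- M) M))).
move=> x /AM; rewrite prod_normE ge_max => /andP[x1 x2].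
by split; rewrite /= in_itv /= -ler_norml.
Qed.

Lemma within_continuous_precomp (X Y Z : topologicalType) (A : set Y)
    (f : Y -> Z) (g : X -> Y) : {within A, continuous f} -> continuous g ->
  (forall x, A (g x)) -> continuous (f \o g).
Proof.
move=> cf cg Ag x W WK /=.
have /(_ W WK) := (subspace_continuousP _ _).1 cf (g x) (Ag x).
rewrite /within /= => /cg H.
have {}H : nbhs x [set y | A (g y) -> W (f (g y))] by exact: H.
change (nbhs x [set y | W (f (g y))]).
by apply: filterS H => y /(_ (Ag y)).
Qed.

(** Anticlockwise parametrisation of the circle of radius [r]. *)
Definition circ r t : R * R := (r * cos t, r * sin t).

Lemma continuous_circ r : continuous (circ r).
Proof.
move=> t; apply/cvg_pairP; split => /=; apply: cvgM.
- exact: cvg_cst.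
- exact: continuous_cos.
- exact: cvg_cst.
- exact: continuous_sin.
Qed.

Lemma cmod_circ r t : 0 <= r -> cmod (circ r t) = r.
Proof.
move=> r0; rewrite /cmod /csqn /= !exprMn -mulrDr cos2Dsin2 mulr1 sqrtr_sqr.
by rewrite ger0_norm.
Qed.

Lemma circ_period r : circ r (2 * pi) = circ r 0.
Proof. by rewrite /circ mulr_natl cos2pi sin2pi cos0 sin0. Qed.

(** [F] maps the circle of radius [r] to a loop of winding number [n] around
    the origin: along the circle, [F] has a continuous logarithm, which
    increases by [2 * pi * n] times the imaginary unit in one turn. *)
Definition winds F r n : Prop := exists a : R -> R * R,
  [/\ continuous a, (forall t, F (circ r t) = cexp (a t)) &
      a (2 * pi) = a 0 + (0, 2 * pi * n%:~R)].

Lemma winds_ext F G r n : 0 <= r ->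
  (forall x, cmod x = r -> F x = G x) -> winds F r n -> winds G r n.
Proof.
move=> r0 FG [a [ca Fa ae]]; exists a; split => // t.
by rewrite -FG ?Fa// cmod_circ.
Qed.

Lemma winds_mul F G r n m :
  winds F r n -> winds G r m -> winds (fun x => cmul (F x) (G x)) r (n + m).
Proof.
move=> [a [ca Fa ae]] [b [cb Gb be]]; exists (fun t => a t + b t); split.
- by move=> t; apply: cvgD; [exact: ca|exact: cb].
- by move=> t; rewrite Fa Gb cexpD.
- by rewrite ae be; apply: pairE => /=; rewrite ?intrD; ring.
Qed.

Lemma winds_conj F r n : winds F r n -> winds (fun x => cconj (F x)) r (- n).
Proof.
move=> [a [ca Fa ae]]; exists (fun t => cconj (a t)); split.
- by move=> t; apply: cvg_cconj; exact: ca.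
- by move=> t; rewrite Fa cexpJ.
- by rewrite ae; apply: pairE => /=; rewrite ?intrN; ring.
Qed.

Lemma winds_cexp F r (A : set (R * R)) (u : R * R -> R * R) : 0 <= r ->
  {within A, continuous u} -> (forall x, cmod x = r -> A x) ->
  (forall x, cmod x = r -> F x = cexp (u x)) -> winds F r 0.
Proof.
move=> r0 cu rA Fu; exists (u \o circ r); split.
- apply: within_continuous_precomp cu (@continuous_circ r) _ => t.
  by apply: rA; rewrite cmod_circ.
- by move=> t; rewrite Fu ?cmod_circ.
- by rewrite /= circ_period; apply: pairE => /=; ring.
Qed.

Lemma winds_id r : 0 < r -> winds id r 1.
Proof.
move=> r0; exists (fun t => (ln r, t)); split.
- by move=> t; apply/cvg_pairP; split => /=; [exact: cvg_cst|exact: cvg_id].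
- by move=> t; rewrite /cexp /= lnK.
- by apply: pairE => /=; ring.
Qed.

(** A continuous function with values in the multiples of [2 * pi] does not
    increase. *)
Lemma cos1_constant (d : R -> R) : continuous d -> (forall t, cos (d t) = 1) ->
  d (2 * pi) <= d 0.
Proof.
move=> cd cosd; rewrite leNgt; apply/negP => lt.
(* By the intermediate value theorem, [d] takes the value [d 0 + e] with
   [0 < e <= pi], where the cosine is not [1]. *)
pose e := Num.min pi (d (2 * pi) - d 0).
have e0 : 0 < e by rewrite lt_min pi_gt0 subr_gt0.
have [] := @IVT R d 0 (2 * pi) (d 0 + e).
- by rewrite mulr_ge0// pi_ge0.
- exact: continuous_subspaceT.
- rewrite (min_idPl _) ?(max_idPr _) ?(ltW lt)// lerDl (ltW e0) /=.
  by rewrite -lerBrDl ge_min lexx orbT.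
- move=> c _ dc; have := cosd c; rewrite dc cosD cosd.
  have -> : sin (d 0) = 0 by apply: cos1sin0; rewrite cosd normr1.
  rewrite mul1r mul0r subr0 -cos0 => /cos_inj; rewrite !in_itv /=.
  rewrite lexx pi_ge0 (ltW e0) ge_min lexx /= => /(_ isT isT) e00.
  by rewrite e00 ltxx in e0.
Qed.

Lemma winds_unique F r n m : winds F r n -> winds F r m -> n = m.
Proof.
move=> [a [ca Fa ae]] [b [cb Fb be]].
have a2 : continuous (fun t => (a t).2) by move=> t; have [_] := (cvg_pairP _ _).1 (ca t).
have b2 : continuous (fun t => (b t).2) by move=> t; have [_] := (cvg_pairP _ _).1 (cb t).
have cosab t : cos ((a t).2 - (b t).2) = 1.
  have ab : cexp (a t) = cexp (b t) by rewrite -Fa Fb.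
  have e1 : cmod (cexp (a t)) = cmod (cexp (b t)) by rewrite ab.
  have [] := ab; rewrite !cmod_cexp in e1.
  have /lt0r_neq0 e0 := expR_gt0 (b t).1.
  rewrite e1 => /(mulfI e0) c /(mulfI e0) s.
  by rewrite cosB c s -!expr2 cos2Dsin2.
have cosba t : cos ((b t).2 - (a t).2) = 1 by rewrite -cosN opprB.
have := @cos1_constant (fun t => (a t).2 - (b t).2).
have := @cos1_constant (fun t => (b t).2 - (a t).2).
rewrite ae be /=.
move=> /(_ (fun t => cvgB (b2 t) (a2 t)) cosba) h1.
move=> /(_ (fun t => cvgB (a2 t) (b2 t)) cosab) h2.
have : 2 * pi * n%:~R = 2 * pi * m%:~R :> R by lra.
have p0 : 2 * pi != 0 :> R by rewrite mulf_neq0 ?pnatr_eq0// gt_eqF// pi_gt0.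
by move=> /(mulfI p0) /intr_inj.
Qed.

(** [x - a] is [x] times [1 - a / x], which is in the right half-plane on a
    circle around [a]. *)
Lemma winds_sub r (a : R * R) : cmod a < r -> winds (fun x => x - a) r 1.
Proof.
move=> ar; have r0 : 0 < r by exact: le_lt_trans (cmod_ge0 _) ar.
rewrite -[1]addr0.
pose q x := cmul (x - a) (cinv x).
have neq0 x : cmod x = r -> x != 0 by move=> xr; rewrite -cmod_gt0 xr.
have q1 x : cmod x = r -> 0 < (q x).1.
  move=> xr; have x0 := neq0 _ xr.
  rewrite /q cmulBl cmulV//= subr_gt0.
  set z := _ - _; have -> : z = (cmul a (cinv x)).1 by [].
  apply: le_lt_trans (le_trans (ler_norm _) (normr1_le_cmod _)) _.
  by rewrite cmodM cmodV// xr ltr_pdivrMr// mul1r.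
apply: (@winds_ext (fun x => cmul x (q x))); first exact: ltW.
  by move=> x /neq0 x0; rewrite /q cmulC cmulVK.
apply: winds_mul; first exact: winds_id.
apply: (@winds_cexp _ _ [set x | cmod x = r] (fun x => clog (q x))) => //.
- exact: ltW.
- apply/subspace_continuousP => x /= xr; apply: cvg_clog; first exact: q1.
  apply: (cvg_within_filter (f := q)).
  apply: cvg_cmul; first by apply: cvgB; [exact: cvg_id|exact: cvg_cst].
  by apply: cvg_cinv; [exact: neq0|exact: cvg_id].
- by move=> x xr; rewrite cexp_clog//; exact: q1.
Qed.

(** Contracting the disc to its centre gives a logarithm of [F] on the disc. *)
Lemma winds_nonvanishing F r : 0 <= r ->
  continuous F -> (forall x, F x != 0) -> winds F r 0.
Proof.
move=> r0 cF F0.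
have [c Fc] := cexp_surj (F0 0).
pose A := [set x : R * R | cmod x <= r].
have cA : compact A.
  apply: (@compact_plane _ r) => [|x]; last exact: le_trans (norm_le_cmod x).
  apply: (@closed_comp _ _ (@cmod R) [set t | t <= r]); last exact: closed_le.
  by move=> x _; apply: cvg_cmod; exact: cvg_id.
have [||u [cu ue]] := @homotopy_log R _ A (fun t x => F (t *: x)) cA.
- apply: (@continuous_subspaceT _ _ _ (F \o (fun z : R * (R * R) => z.1 *: z.2))).
  by move=> p; apply: continuous_comp; [exact: scale_continuous|exact: cF].
- by move=> t x _ _; exact: F0.
apply: (@winds_cexp _ _ A (fun x => u x + c)) => //.
- by move=> x; apply: cvgD; [exact: cu|exact: cvg_cst].
- by move=> x xr; rewrite /A /= xr.
- move=> x xr; have /ue : A x by rewrite /A /= xr.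
  by rewrite scale1r scale0r Fc -cexpD.
Qed.

End Winding.

(** * Zeros inside a circle count the winding number *)

Section SimpleZeros.
Variable R : realType.
Implicit Types (H G k : R * R -> R * R) (a x p : R * R) (b : bool) (r c : R).

(** The identity for [b = true], the conjugation for [b = false]. *)
Definition cflip b x : R * R := if b then x else cconj x.

(** The winding number of [cflip b] around the origin. *)
Definition csign b : int := if b then 1 else -1.

(** Near [a], the map [H] is close, with relative error less than [1], to
    [p * (x - a)] if [b] and to the conjugate model otherwise. *)
Definition simple_zero H a b : Prop := exists p c,
  [/\ p != 0, 0 <= c < 1 & \forall x \near a,
    cmod (H x - cmul p (cflip b (x - a))) <= c * cmod p * cmod (x - a)].

Lemma cmod_cflip b x : cmod (cflip b x) = cmod x.
Proof. by case: b => //=; rewrite cmodJ. Qed.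

Lemma cflip_neq0 b x : (cflip b x != 0) = (x != 0).
Proof. by rewrite -!cmod_gt0 cmod_cflip. Qed.

Lemma cvg_cflip b (I : Type) (F : set_system I) (FF : Filter F)
    (f : I -> R * R) a :
  f x @[x --> F] --> a -> cflip b (f x) @[x --> F] --> cflip b a.
Proof. by case: b => //; exact: cvg_cconj. Qed.

Lemma cvg_min1 (I : Type) (F : set_system I) (FF : Filter F) (f : I -> R) c :
  f x @[x --> F] --> c -> Num.min 1 (f x) @[x --> F] --> Num.min 1 c.
Proof.
move=> fc; under eq_fun do rewrite minr_absE; rewrite minr_absE.
apply: cvgM; last exact: cvg_cst.
apply: cvgB; first by apply: cvgD => //; exact: cvg_cst.
by apply: cvg_norm; apply: cvgB => //; exact: cvg_cst.
Qed.

Lemma winds_cflip b r a : cmod a < r -> winds (fun x => cflip b (x - a)) r (csign b).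
Proof. by move=> ar; case: b; [|apply: winds_conj]; exact: winds_sub. Qed.

Lemma simple_zero_near H G a b : (\forall x \near a, H x = G x) ->
  simple_zero H a b -> simple_zero G a b.
Proof.
move=> HG [p [c [p0 c01 Hp]]]; exists p, c; split => //.
by apply: filterS2 HG Hp => x ->.
Qed.

Lemma simple_zero_mul H k a b : {for a, continuous k} -> k a != 0 ->
  simple_zero H a b -> simple_zero (fun x => cmul (H x) (k x)) a b.
Proof.
move=> ck ka0 [p [c [p0 /andP[c0 c1] Hp]]].
exists (cmul p (k a)), ((1 + c) / 2); split.
- exact: cmul_neq0.
- by apply/andP; split; lra.
have kap : 0 < cmod (k a) by rewrite cmod_gt0.
have cvk : cmod (k x) * c + cmod (k x - k a) @[x --> a] --> cmod (k a) * c + cmod (k a - k a).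
  apply: cvgD; first by apply: cvgM; [exact: cvg_cmod|exact: cvg_cst].
  by apply: cvg_cmod; apply: cvgB => //; exact: cvg_cst.
have : \forall x \near a,
    cmod (k x) * c + cmod (k x - k a) <= (1 + c) / 2 * cmod (k a).
  apply: cvgr_le cvk _ _.
  rewrite subrr cmod0 addr0; nra.
apply: filterS2 Hp => x Hx kx.
set z := cflip b (x - a) in Hx *.
have -> : cmul (H x) (k x) - cmul (cmul p (k a)) z =
    cmul (H x - cmul p z) (k x) + cmul (cmul p z) (k x - k a).
  by apply: pairE => /=; ring.
apply: le_trans (cmodD _ _) _; rewrite !cmodM cmod_cflip.
have := cmod_ge0 p; have := cmod_ge0 (x - a); have := cmod_ge0 (k x).
move: Hx kx; set X := cmod (H x - _); set P := cmod p; set D := cmod (x - a).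
set Q := cmod (k x); set S := cmod (k x - k a) => Hx kx Q0 D0 P0.
apply: (@le_trans _ _ ((Q * c + S) * (P * D))).
  by rewrite mulrDl [S * _]mulrC lerD2r -mulrA mulrC ler_wpM2l// mulrA.
apply: (@le_trans _ _ ((1 + c) / 2 * cmod (k a) * (P * D))).
  by rewrite ler_wpM2r ?mulr_ge0.
by rewrite le_eqVlt; apply/orP; left; apply/eqP; ring.
Qed.

(** Division by [cflip b (x - a)] removes the zero [a] of [H], up to a
    modification in the disc of centre [a] and radius [d]. *)
Lemma remove_zero H a b (e : R) : continuous H -> simple_zero H a b -> 0 < e ->
  exists G d, [/\ continuous G, 0 < d <= e,
    forall x, d <= cmod (x - a) -> H x = cmul (G x) (cflip b (x - a)),
    forall x, G x = 0 -> H x = 0 /\ x != a &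
    forall x, x != a -> H x = 0 -> d < cmod (x - a)].
Proof.
move=> cH [p [c [p0 /andP[c0 c1] /nbhs_normP[e1 /= e10 Hp]]]] e0.
pose d := Num.min e (e1 / 2).
have d0 : 0 < d by rewrite lt_min e0 divr_gt0.
have cp : 0 < cmod p by rewrite cmod_gt0.
have He x : cmod (x - a) <= d ->
    cmod (H x - cmul p (cflip b (x - a))) <= c * cmod p * cmod (x - a).
  move=> xd; apply: Hp => /=; rewrite distrC.
  apply: le_lt_trans (norm_le_cmod _) _; apply: le_lt_trans xd _.
  by rewrite gt_min; apply/orP; right; lra.
(* In the disc, the quotient [q] stays, except at [a], in a closed disc of
   centre [p] that does not contain the origin; it is contracted to [p] near
   [a] to get a continuous nonvanishing function. *)
pose q x := cmul (H x) (cinv (cflip b (x - a))).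
pose X x := Num.min 1 (cmod (x - a) / d).
pose G x := p + X x *: (q x - p).
have X01 x : 0 <= X x <= 1.
  by rewrite le_min ler01 ge_min lexx !divr_ge0 ?cmod_ge0// ltW.
have Xa : X a = 0.
  by rewrite /X subrr cmod0 mul0r; apply/min_idPr; exact: ler01.
have Xd x : d <= cmod (x - a) -> X x = 1.
  by move=> dx; apply/min_idPl; rewrite ler_pdivlMr// mul1r.
have qp x : x != a -> cmod (x - a) <= d -> cmod (q x - p) <= c * cmod p.
  move=> xa xd; have fx : cflip b (x - a) != 0 by rewrite cflip_neq0 subr_eq0.
  have D0 : 0 < cmod (x - a) by rewrite cmod_gt0 subr_eq0.
  have -> : q x - p = cmul (H x - cmul p (cflip b (x - a))) (cinv (cflip b (x - a))).
    by rewrite cmulBl -cmulA cmulV// cmul1.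
  by rewrite cmodM cmodV// cmod_cflip ler_pdivrMr//; exact: He.
have cmodZ (t : R) x : cmod (t *: x) = `|t| * cmod x.
  rewrite /cmod /csqn /= -[t *: x.1]/(t * x.1) -[t *: x.2]/(t * x.2).
  by rewrite !exprMn -mulrDr sqrtrM ?sqr_ge0// sqrtr_sqr.
have Gp x : cmod (x - a) <= d -> cmod (G x - p) <= X x * (c * cmod p).
  move=> xd; rewrite /G addrC addKr cmodZ ger0_norm; last by case/andP: (X01 x).
  have [->|xa] := eqVneq x a; first by rewrite Xa !mul0r.
  by apply: ler_wpM2l; [case/andP: (X01 x)|exact: qp].
have G0 x : cmod (x - a) <= d -> G x != 0.
  move=> xd; apply/eqP => Gx; have := Gp x xd; rewrite Gx sub0r cmodN.
  have /andP[X0 X1] := X01 x; move=> h.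
  have : X x * (c * cmod p) <= c * cmod p by rewrite ler_piMl// mulr_ge0// ltW.
  nra.
exists G, d; split.
- move=> x; have [->|xa] := eqVneq x a.
    have Ga : G a = p by rewrite /G Xa scale0r addr0.
    rewrite /continuous_at Ga.
    have cvD : cmod (x - a) / d * (c * cmod p) @[x --> a] --> cmod (a - a) / d * (c * cmod p).
      apply: cvgM; last exact: cvg_cst.
      apply: cvgM; last exact: cvg_cst.
      by apply: cvg_cmod; apply: cvgB; [exact: cvg_id|exact: cvg_cst].
    apply/cvgrPdist_le => t t0.
    have n1 : \forall x \near a, cmod (x - a) / d * (c * cmod p) <= t.
      by apply: cvgr_le cvD _ _; rewrite subrr cmod0 !mul0r.
    have n2 : \forall x \near a, cmod (x - a) <= d.
      have cva : cmod (x - a) @[x --> a] --> cmod (a - a).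
        by apply: cvg_cmod; apply: cvgB; [exact: cvg_id|exact: cvg_cst].
      by apply: cvgr_le cva _ _; rewrite subrr cmod0.
    apply: filterS2 n1 n2 => y y1 y2; rewrite distrC.
    apply: le_trans (norm_le_cmod _) _; apply: le_trans (Gp _ y2) _.
    apply: le_trans y1; apply: ler_wpM2r; first by rewrite mulr_ge0// ltW.
    by rewrite /X ge_min lexx orbT.
  have cva : y - a @[y --> x] --> x - a.
    by apply: cvgB; [exact: cvg_id|exact: cvg_cst].
  apply: cvgD; first exact: cvg_cst.
  apply: cvgZ.
    by apply: cvg_min1; apply: cvgM; [exact: cvg_cmod|exact: cvg_cst].
  apply: cvgB; last exact: cvg_cst.
  apply: cvg_cmul; first exact: cH.
  apply: cvg_cinv; first by rewrite cflip_neq0 subr_eq0.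
  exact: cvg_cflip.
- by rewrite d0 ge_min lexx.
- move=> x dx; have x0 : cflip b (x - a) != 0.
    by rewrite cflip_neq0 -cmod_gt0; exact: lt_le_trans dx.
  by rewrite /G Xd// scale1r addrC subrK /q cmulVK.
- move=> x Gx; have dx : d < cmod (x - a).
    by rewrite ltNge; apply/negP => /G0; rewrite Gx eqxx.
  have xa : x - a != 0 by rewrite -cmod_gt0; exact: lt_trans dx.
  rewrite subr_eq0 in xa; split => //.
  move: Gx; rewrite /G Xd ?ltW// scale1r addrC subrK /q => Gx.
  have fx : cflip b (x - a) != 0 by rewrite cflip_neq0 subr_eq0.
  by rewrite -[H x](cmulVK _ fx) Gx cmulC cmul0.
- move=> x xa Hx; rewrite ltNge; apply/negP => xd.
  have := qp x xa xd; rewrite /q Hx cmulC cmul0 sub0r cmodN; nra.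
Qed.

(** The argument principle for a continuous map with finitely many simple zeros
    in the plane, all of them inside the circle. *)
Lemma winds_sum_sign (s : seq (R * R)) (b : R * R -> bool) H r :
  continuous H -> uniq s -> (forall x, (H x == 0) = (x \in s)) ->
  (forall a, a \in s -> simple_zero H a (b a)) ->
  0 < r -> (forall a, a \in s -> cmod a < r) ->
  winds H r (\sum_(a <- s) csign (b a)).
Proof.
move=> + + + + r0; elim: s H => [|a s IHs] H cH us Hs sz sr.
  rewrite big_nil; apply: winds_nonvanishing => //; first exact: ltW.
  by move=> x; rewrite Hs.
have ar : cmod a < r by apply: sr; rewrite mem_head.
have [|G [d [cG /andP[d0 de] HG G0 Hd]]] :=
    remove_zero (e := r - cmod a) cH (sz a (mem_head _ _)).
  by rewrite subr_gt0.
case/andP: us => as' us.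
rewrite big_cons addrC.
apply: (@winds_ext _ (fun x => cmul (G x) (cflip (b a) (x - a)))); first exact: ltW.
  move=> x xr; rewrite HG//; apply: le_trans de _; rewrite lerBlDr -xr.
  by rewrite -{1}(subrK a x); exact: cmodD.
apply: winds_mul; last exact: winds_cflip.
have sNa x : x \in s -> [/\ x != a, H x = 0 & d < cmod (x - a)].
  move=> xs; have xa : x != a by apply: contraNneq as' => <-.
  have Hx : H x = 0 by apply/eqP; rewrite Hs inE xs orbT.
  by split => //; exact: Hd.
apply: IHs => //.
- move=> x; apply/eqP/idP => [/G0[/eqP]|xs].
    by rewrite Hs inE => /orP[->|].
  have [xa Hx dx] := sNa x xs; move: Hx; rewrite HG ?ltW// => e.
  apply/eqP; apply: contraTT isT => Gx.
  have fx : cflip (b a) (x - a) != 0 by rewrite cflip_neq0 subr_eq0.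
  by have := cmul_neq0 Gx fx; rewrite e eqxx.
- move=> x xs; have [xa Hx dx] := sNa x xs.
  have cva (y : R * R) : z - a @[z --> y] --> y - a.
    by apply: cvgB; [exact: cvg_id|exact: cvg_cst].
  apply: (@simple_zero_near (fun y => cmul (H y) (cinv (cflip (b a) (y - a))))).
    have : \forall y \near x, d < cmod (y - a).
      by apply: cvgr_gt (cvg_cmod (cva x)) _ dx.
    apply: filterS => y dy; have y0 : cflip (b a) (y - a) != 0.
      by rewrite cflip_neq0 -cmod_gt0; exact: lt_trans dy.
    by rewrite HG ?ltW// -cmulA cmulV// cmul1.
  have x0 : cflip (b a) (x - a) != 0 by rewrite cflip_neq0 subr_eq0.
  apply: simple_zero_mul; last by apply: sz; rewrite inE xs orbT.
  + by apply: cvg_cinv => //; apply: cvg_cflip; exact: cva.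
  + exact: cinv_neq0.
- by move=> x xs; apply: sr; rewrite inE xs orbT.
Qed.

End SimpleZeros.

(** * Zeros of a map that is homotopic to the identity on the boundary *)

Section SimpleZeroDerivative.
Variable R : realType.
Implicit Types (h : R * R -> R * R) (a : R * R).

(** A nondegenerate zero is simple, with the sign of the Jacobian determinant. *)
Lemma simple_zero_differentiable h a : differentiable h a -> h a = 0 ->
  jacobian_det h a != 0 -> simple_zero h a (0 < jacobian_det h a).
Proof.
move=> dh ha J0.
have [D1 D1E] : {D1 | 'D_(1, 0) h a = D1} by exists ('D_(1, 0) h a).
have [D2 D2E] : {D2 | 'D_(0, 1) h a = D2} by exists ('D_(0, 1) h a).
(* In complex notation, the differential is [v |-> p * v + q * conj v], with
   Jacobian determinant [|p|^2 - |q|^2]. *)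
pose p : R * R := ((D1.1 + D2.2) / 2, (D1.2 - D2.1) / 2).
pose q : R * R := ((D1.1 - D2.2) / 2, (D1.2 + D2.1) / 2).
have dE v : 'd h a v = cmul p v + cmul q (cconj v).
  have vE : v = v.1 *: ((1, 0) : R * R) + v.2 *: ((0, 1) : R * R).
    by apply: pairE; rewrite /= /GRing.scale /=; ring.
  have : 'd h a v = v.1 *: D1 + v.2 *: D2.
    by rewrite {1}vE linearD !linearZ -D1E -D2E !deriveE.
  move=> ->; rewrite {vE}; apply: pairE => /=.
    by rewrite -[v.1 *: _]/(v.1 * D1.1) -[v.2 *: _]/(v.2 * D2.1); field.
  by rewrite -[v.1 *: _]/(v.1 * D1.2) -[v.2 *: _]/(v.2 * D2.2); field.
have JE : jacobian_det h a = csqn p - csqn q.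
  by rewrite /jacobian_det D1E D2E /csqn /=; field.
pose b := 0 < jacobian_det h a.
have [P [Q [QP dPQ]]] : exists P Q, cmod Q < cmod P /\
    forall v, 'd h a v = cmul P (cflip b v) + cmul Q (cflip (~~ b) v).
  have lt_mod z w : csqn z < csqn w -> cmod z < cmod w.
    by move=> zw; rewrite /cmod ltr_sqrt// (le_lt_trans (csqn_ge0 z)).
  rewrite /b; have [J|J|J] := ltrgtP 0 (jacobian_det h a).
  - by exists p, q; split => //; apply: lt_mod; lra.
  - by exists q, p; split => [|v]; [apply: lt_mod; lra|rewrite dE addrC].
  - by rewrite -J eqxx in J0.
have P0 : 0 < cmod P by exact: le_lt_trans (cmod_ge0 Q) QP.
exists P, ((cmod P + cmod Q) / (2 * cmod P)); split.
- by rewrite -cmod_gt0.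
- apply/andP; split.
    by rewrite divr_ge0 ?addr_ge0 ?cmod_ge0// mulr_ge0// cmod_ge0.
  by rewrite ltr_pdivrMr; lra.
have e0 : 0 < (cmod P - cmod Q) / 4 by rewrite divr_gt0// subr_gt0.
have /eqaddoP/(_ _ e0) := diff_locally dh.
move=> /nbhs_normP[e1 /= e10 He]; apply/nbhs_normP; exists e1 => //= x xa.
have /He : ball_ (fun z : R * R => `|z|) 0 e1 (x - a) by rewrite /= sub0r normrN distrC.
rewrite /= !fctE /= subrK ha add0r dPQ => Hx.
set z := x - a in Hx *.
set y := h x - _ in Hx.
have -> : h x - cmul P (cflip b z) = y + cmul Q (cflip (~~ b) z).
  by rewrite /y opprD addrA subrK.
apply: le_trans (cmodD _ _) _; rewrite cmodM cmod_cflip.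
have n1 := cmod_le_norm y; have n2 := norm_le_cmod z.
have n3 : 0 <= (cmod P - cmod Q) * (cmod z - `|z|).
  by rewrite mulr_ge0// subr_ge0// ltW.
have {}Hx : `|y| <= (cmod P - cmod Q) / 4 * `|z| by exact: Hx.
have -> : (cmod P + cmod Q) / (2 * cmod P) * cmod P * cmod z =
    (cmod P + cmod Q) / 2 * cmod z by field; exact: lt0r_neq0.
move: n1 n2 n3 Hx; move: (cmod y) (`|y|) (cmod z) (`|z|) (cmod P) (cmod Q).
by move=> *; lra.
Qed.

End SimpleZeroDerivative.

Section BoundaryExtension.
Variable R : realType.
Implicit Types (h : R * R -> R * R) (U : set (R * R)).

Lemma closed_boundary (T : topologicalType) (U : set T) : closed (boundary U).
Proof.
rewrite /boundary setDE; apply: closedI; first exact: closed_closure.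
by apply: open_closedC; exact: open_interior.
Qed.

Lemma boundary_open (T : topologicalType) (U : set T) x :
  open U -> boundary U x -> closure U x /\ ~ U x.
Proof. by move=> oU [cU]; rewrite ((interior_id U).1 oU). Qed.

Lemma closure_open (T : topologicalType) (U : set T) x :
  open U -> closure U x -> ~ U x -> boundary U x.
Proof. by move=> oU cU nU; split => //; rewrite ((interior_id U).1 oU). Qed.

Lemma bounded_closure U : bounded_set U ->
  exists2 M, 0 < M & forall x, closure U x -> `|x| <= M.
Proof.
move=> /ex_strict_bound_gt0[M M0 UM]; exists M => // x xU.
have : closed [set x : R * R | `|x| <= M].
  apply: (@closed_comp _ _ (fun x : R * R => `|x|) [set t | t <= M]).
    by move=> y _; exact: norm_continuous.
  exact: closed_le.
rewrite closure_id => cE.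
have /closureS : U `<=` [set x : R * R | `|x| <= M] by move=> y /UM/ltW.
by rewrite -cE; exact.
Qed.

Lemma compact_closure_bounded U : bounded_set U -> compact (closure U).
Proof.
move=> /bounded_closure[M M0 UM].
exact: (compact_plane (@closed_closure _ U) UM).
Qed.

Lemma compact_boundary U : bounded_set U -> compact (boundary U).
Proof.
move=> bU; apply: subclosed_compact (compact_closure_bounded bU) _.
  exact: closed_boundary.
by move=> x [].
Qed.

(** Componentwise Tietze extension. *)
Lemma continuous_extension_plane (A : set (R * R)) (v : R * R -> R * R) :
  compact A -> closed A -> {within A, continuous v} ->
  exists2 w, continuous w & forall x, A x -> w x = v x.
Proof.
move=> kA cA cv.
have /ex_strict_bound_gt0[M M0 vM] : bounded_set (v @` A).
  by apply: compact_bounded; exact: continuous_compact.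
have vM' x : A x -> `|(v x).1| <= M /\ `|(v x).2| <= M.
  move=> Ax; have /ltW := vM _ (imageP v Ax).
  by rewrite prod_normE ge_max => /andP[].
have cv1 : {within A, continuous (fun x => (v x).1)}.
  by move=> x; have [] := (cvg_pairP _ _).1 (cv x).
have cv2 : {within A, continuous (fun x => (v x).2)}.
  by move=> x; have [] := (cvg_pairP _ _).1 (cv x).
have nR : normal_space (R * R)%type := @pseudometric_normal R _.
have [w1 [w1v cw1 _]] := continuous_bounded_extension nR cA M0 cv1
  (fun x Ax => (vM' x Ax).1).
have [w2 [w2v cw2 _]] := continuous_bounded_extension nR cA M0 cv2
  (fun x Ax => (vM' x Ax).2).
exists (fun x => (w1 x, w2 x)) => [x|x Ax].
  by apply/cvg_pairP; split => /=; [exact: cw1|exact: cw2].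
by rewrite -w1v -?w2v ?inE//; case: (v x).
Qed.

(** If [h x] is [x] times a continuous exponential on the boundary of [U], then
    the signs of the zeros of [h] in [U] add up to [1]. *)
Lemma sum_sign_boundary U h (v : R * R -> R * R) (s : seq (R * R))
    (b : R * R -> bool) :
  open U -> bounded_set U -> U 0 -> {within closure U, continuous h} ->
  {within boundary U, continuous v} ->
  (forall x, boundary U x -> h x = cmul (cexp (v x)) x) ->
  uniq s -> (forall x, U x /\ h x = 0 <-> x \in s) ->
  (forall a, a \in s -> simple_zero h a (b a)) ->
  \sum_(a <- s) csign (b a) = 1.
Proof.
move=> oU bU U0 ch cv hv us sU sz.
have [w cw wv] := continuous_extension_plane (compact_boundary bU)
  (@closed_boundary _ U) cv.
(* Outside [U], [h] is replaced by [g], which does not vanish there as [0] is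
   in [U]; the result [H] is continuous on the whole plane, so that the holes
   of [U] do not matter. *)
pose g x := cmul (cexp (w x)) x.
have cg : continuous g.
  move=> x; apply: cvg_cmul; last exact: cvg_id.
  by apply: cvg_cexp; exact: cw.
pose H x := if x \in U then h x else g x.
have HU x : closure U x -> H x = h x.
  rewrite /H => cx; case: ifPn => //; rewrite notin_setE => nUx.
  have bx := closure_open oU cx nUx.
  by rewrite hv// /g wv.
have HC x : ~ U x -> H x = g x by rewrite /H => nU; rewrite memNset.
have cH : continuous H.
  have -> : continuous H <-> {within closure U `|` ~` U, continuous H}.
    have -> : closure U `|` ~` U = setT.
      by rewrite -subTset => x _; have [/subset_closure|] := pselect (U x); [left|right].
    by rewrite -continuous_subspace_setT.
  apply: withinU_continuous.
  - exact: closed_closure.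
  - exact: open_closedC.
  - apply: (subspace_eq_continuous (f := h)) => //.
    by move=> x; rewrite inE => /HU.
  - apply: (subspace_eq_continuous (f := g)); last exact: continuous_subspaceT.
    by move=> x; rewrite inE => /HC.
have [M M0 UM] := bounded_closure bU.
pose r := 2 * M + 1.
have r0 : 0 < r by rewrite addr_gt0// mulr_gt0.
have Ur x : U x -> cmod x < r.
  move=> Ux; have := cmod_le_norm x; have := UM x (subset_closure Ux).
  by rewrite /r; lra.
have rU x : cmod x = r -> ~ U x by move=> xr /Ur; rewrite xr ltxx.
apply: (@winds_unique R H r).
- apply: winds_sum_sign => //.
  + move=> x; apply/eqP/idP => [|/sU[Ux hx]].
      have [Ux Hx|nUx] := pselect (U x).
        by apply/sU; split => //; rewrite -HU//; exact: subset_closure.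
      rewrite HC// => /eqP; rewrite /g; apply: contraTT => _.
      apply: cmul_neq0; first exact: cexp_neq0.
      by apply/eqP => x0; apply: nUx; rewrite x0.
    by rewrite HU//; exact: subset_closure.
  + move=> a /[dup] /sU[Ua _] /sz; apply: simple_zero_near.
    have := open_nbhs_nbhs (conj oU Ua); apply: filterS => x Ux.
    by rewrite HU//; exact: subset_closure.
  + by move=> a /sU[/Ur].
- apply: (@winds_ext _ g); first exact: ltW.
    by move=> x /rU /HC.
  rewrite -[1]add0r; apply: winds_mul; last exact: winds_id.
  apply: (@winds_cexp _ _ _ setT w) => //; first exact: ltW.
  exact: continuous_subspaceT.
Qed.

End BoundaryExtension.

(** * Radial contraction in polar-like coordinates *)

Section RadialContraction.
Variables (R : realType) (Psi : R * R -> R * R).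
Hypothesis Psi_polar : polar_like Psi.
Implicit Types (y z : R * R) (l t r : R).

Lemma polar_periodicz (k : int) t r : 0 <= r ->
  Psi (t + 2 * pi * k%:~R, r) = Psi (t, r).
Proof.
move=> r0; have nat n s : Psi (s + 2 * pi * n%:R, r) = Psi (s, r).
  elim: n s => [|n IHn] s; first by rewrite mulr0 addr0.
  have -> : s + 2 * pi * n.+1%:R = s + 2 * pi * n%:R + 2 * pi.
    by rewrite -addn1 natrD; ring.
  by rewrite (polar_periodic Psi_polar).
case: k => n; first exact: (nat n t).
by have := nat n.+1 (t + 2 * pi * (Negz n)%:~R); rewrite NegzE mulrNz mulrN subrK.
Qed.

Lemma polar_surj z : z != 0 -> exists2 y, 0 < y.2 & Psi y = z.
Proof.
move=> z0; have [_ _ /(_ z)] := polar_bij Psi_polar.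
case=> [|y [_ y2] yz]; first exact/eqP.
by exists y.
Qed.

Lemma polar_radius0 t : Psi (t, 0) = 0.
Proof. by apply: (polar_zero Psi_polar _).2 => //; exact: lexx. Qed.

Lemma polar_neq0 y : 0 < y.2 -> Psi y != 0.
Proof.
move=> y2; apply/eqP => /(polar_zero Psi_polar (ltW y2)) y20.
by rewrite y20 ltxx in y2.
Qed.

Lemma polar_inj y z : 0 < y.2 -> 0 < z.2 -> Psi y = Psi z ->
  y.2 = z.2 /\ exists k : int, y.1 = z.1 + 2 * pi * k%:~R.
Proof.
move=> y2 z2 yz; have p0 : 0 < 2 * pi :> R by rewrite mulr_gt0// pi_gt0.
pose q (t : R) : int := Num.floor (t / (2 * pi)).
pose m (t : R) := t - 2 * pi * (q t)%:~R.
have m01 t : 0 <= m t < 2 * pi.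
  have h1 : (q t)%:~R <= t / (2 * pi) by exact: floor_le.
  have h2 : t / (2 * pi) < (q t)%:~R + 1 by rewrite -[1]/(1%:~R) -intrD floorD1_gt.
  have -> : m t = (t / (2 * pi) - (q t)%:~R) * (2 * pi).
    by rewrite mulrBl divfK ?gt_eqF// [_%:~R * _]mulrC.
  apply/andP; split; first by rewrite mulr_ge0 ?subr_ge0// ltW.
  by rewrite gtr_pMl// ltrBlDl.
have Pm t r : 0 <= r -> Psi (m t, r) = Psi (t, r).
  by move=> r0; rewrite /m -mulrN -intrN polar_periodicz.
have [_ inj _] := polar_bij Psi_polar.
have := inj (m y.1, y.2) (m z.1, z.2).
rewrite !inE /= => /(_ (conj (m01 _) y2) (conj (m01 _) z2)).
rewrite !Pm ?ltW// -!surjective_pairing => /(_ yz)[m12 ->]; split => //.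
exists (q y.1 - q z.1); rewrite intrB mulrBr; move: m12; rewrite /m.
move: (2 * pi * _) (2 * pi * _) => a b; lra.
Qed.

(** For [z != 0], the point [z], at [(theta, r)] in polar-like coordinates, is
    moved to [(theta, l * r)].  The choice of [theta] does not matter, see
    [contractE]. *)
Definition contract l z : R * R :=
  let y := get (polar_preimage Psi [set z]) in Psi (y.1, l * y.2).

Lemma polar_get z : z != 0 ->
  let y := get (polar_preimage Psi [set z]) in 0 < y.2 /\ Psi y = z.
Proof.
move=> z0; have [y y2 yz] := polar_surj z0.
have := getI (_ : polar_preimage Psi [set z] y).
move=> /(_ (conj (ltW y2) yz)); set w := get _ => -[w2 wz]; split => //.
rewrite lt_neqAle; apply/andP; split => //; apply/eqP => w20.
move: z0; rewrite -wz => /eqP; apply.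
by apply/(polar_zero Psi_polar w2).
Qed.

Lemma contractE l y : 0 <= l -> 0 < y.2 ->
  contract l (Psi y) = Psi (y.1, l * y.2).
Proof.
move=> l0 y2; rewrite /contract.
have [] := polar_get (polar_neq0 y2); set w := get _ => w2 wy.
have [-> [k ->]] := polar_inj w2 y2 wy.
by rewrite polar_periodicz// mulr_ge0// ltW.
Qed.

Lemma cvg_contract (I : Type) (F : set_system I) (FF : Filter F)
    (l : I -> R) (z : I -> R * R) (l0 : R) (z0 : R * R) :
  z0 != 0 -> 0 <= l0 -> (\forall i \near F, 0 <= l i) ->
  l i @[i --> F] --> l0 -> z i @[i --> F] --> z0 ->
  contract (l i) (z i) @[i --> F] --> contract l0 z0.
Proof.
move=> z00 l00 l_ge0 cl cz.
have [y0 y02 y0z] := polar_surj z00.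
have [V [g [[oV Vy VH] [_ oPV gP cg]]]] := polar_local_homeo Psi_polar y02.
have PVz0 : (Psi @` V) z0 by exists y0.
have nPV : \forall i \near F, (Psi @` V) (z i).
  by apply: cz; exact: open_nbhs_nbhs.
have cgz : g (z i) @[i --> F] --> y0.
  rewrite -(gP _ Vy) y0z; apply: (continuous_cvg _ _ cz).
  by have := cg; rewrite continuous_open_subspace//; apply; rewrite inE.
have [cg1 cg2] := (cvg_pairP _ _).1 cgz.
pose w i : R * R := ((g (z i)).1, l i * (g (z i)).2).
pose w0 : R * R := (y0.1, l0 * y0.2).
have cw : w i @[i --> F] --> w0.
  by apply/cvg_pairP; split => //=; exact: cvgM.
have w0H : closed_half_plane R w0 by rewrite /closed_half_plane /= mulr_ge0// ltW.
have wE : \forall i \near F, closed_half_plane R (w i) /\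
    contract (l i) (z i) = Psi (w i).
  apply: filterS2 nPV l_ge0 => i [v Vv vz] li.
  have v2 : 0 < v.2 by exact: VH.
  rewrite /w -vz gP// contractE//; split => //.
  by rewrite /closed_half_plane /= mulr_ge0// ltW.
rewrite -y0z contractE// => W WP.
have := (subspace_continuousP _ _).1 (polar_continuous Psi_polar) w0 w0H W WP.
rewrite /within /= => /cw H.
have {}H : \forall i \near F, closed_half_plane R (w i) -> W (Psi (w i)) by exact: H.
change (\forall i \near F, W (contract (l i) (z i))).
by apply: filterS2 H wE => i Hi [wi ->]; exact: Hi.
Qed.

End RadialContraction.

Section BoundaryLogarithm.
Variables (R : realType) (A : set (R * R)).
Hypothesis A_compact : compact A.
Implicit Types f g h : R * R -> R * R.

Lemma within_continuous_snd (B : set R) f : {within A, continuous f} ->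
  {within B `*` A, continuous (fun p : R * (R * R) => f p.2)}.
Proof.
move=> cf; apply/subspace_continuousP => -[t x] [Bt Ax] W WP.
have := (subspace_continuousP _ _).1 cf x Ax W WP.
rewrite /within /= => N; exists (setT, [set y | A y -> W (f y)]).
  by split => //=; exact: filterT.
by move=> [s y] /= [_ AW] [_ Ay]; exact: AW.
Qed.

(** The homotopy along segments, as in Rouche's theorem. *)
Lemma log_close g h : {within A, continuous g} -> {within A, continuous h} ->
  (forall x, A x -> `|h x - g x| < `|g x|) ->
  exists2 u : R * R -> R * R, {within A, continuous u} &
    forall x, A x -> h x = cmul (cexp (u x)) (g x).
Proof.
move=> cg ch hg; pose K (t : R) x := g x + t *: (h x - g x).
have [||u [cu ue]] := @homotopy_log R _ A K A_compact.
- have cg2 := within_continuous_snd (B := `[0, 1]%classic) cg.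
  have ch2 := within_continuous_snd (B := `[0, 1]%classic) ch.
  apply/subspace_continuousP => p Ap.
  have cgp := (subspace_continuousP _ _).1 cg2 p Ap.
  have chp := (subspace_continuousP _ _).1 ch2 p Ap.
  apply: cvgD => //; apply: cvgZ; last exact: cvgB.
  by apply: cvg_within_filter; case: p {Ap cgp chp} => a b; exact: cvg_fst.
- move=> t x /andP[t0 t1] Ax; apply/eqP => Ktx.
  have gx : g x = - (t *: (h x - g x)).
    by apply/eqP; rewrite -addr_eq0; apply/eqP.
  have := hg x Ax; rewrite {2}gx [X in _ < X]normrN [X in _ < X]normrZ ger0_norm// => lt.
  by have := lt_le_trans lt (ler_piMl (normr_ge0 _) t1); rewrite ltxx.
exists u => // x /ue; rewrite /K scale1r scale0r addr0 addrC subrK; exact.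
Qed.

(** If no point of [A] is rotated by a multiple of [2 * pi] by [f], then
    [f x - x] is homotopic to [- x] on [A] by a nonvanishing homotopy, which
    contracts [f x] to the origin along its radius. *)
Lemma log_sub_id (Psi f : R * R -> R * R) : polar_like Psi ->
  {within A, continuous f} ->
  (forall x, A x -> exists y z, [/\ 0 < y.2, 0 < z.2, Psi y = x, Psi z = f x &
    forall k : int, z.1 - y.1 <> 2 * pi * k%:~R]) ->
  exists2 u : R * R -> R * R, {within A, continuous u} &
    forall x, A x -> f x - x = cmul (cexp (u x)) x.
Proof.
move=> PP cf rotf; pose K t x := contract Psi t (f x) - x.
have f0 x : A x -> f x != 0.
  by move=> /rotf[y [z [_ z2 _ <- _]]]; exact: (polar_neq0 PP).
have [||u [cu ue]] := @homotopy_log R _ A K A_compact.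
- have cf2 := within_continuous_snd (B := `[0, 1]%classic) cf.
  have ci2 := within_continuous_snd (B := `[0, 1]%classic)
    (continuous_subspaceT (fun x => @cvg_id _ (nbhs x))).
  apply/subspace_continuousP => p Ap; apply: cvgB.
  + apply: (cvg_contract PP).
    * by case: Ap => _ /f0.
    * by case: Ap; rewrite /= in_itv => /andP[].
    * apply: (filterS _ (@withinT _ (nbhs p) (`[0, 1] `*` A) _)) => q [].
      by rewrite /= in_itv => /andP[].
    * by apply: cvg_within_filter; case: p {Ap} => a b; exact: cvg_fst.
    * exact: (subspace_continuousP _ _).1 cf2 p Ap.
  + exact: (subspace_continuousP _ _).1 ci2 p Ap.
- move=> t x /andP[t0 t1] Ax; rewrite subr_eq0; apply/eqP.
  have [y [z [y2 z2 yx <- rk]]] := rotf x Ax.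
  rewrite (contractE PP)// -yx => e.
  have [t00|tn0] := eqVneq t 0.
    have := polar_neq0 PP y2; rewrite -e t00 mul0r => /eqP; apply.
    exact: polar_radius0.
  have tz : 0 < t * z.2 by rewrite mulr_gt0// lt_neqAle eq_sym tn0.
  have [_ [k /= ke]] := @polar_inj _ _ PP (z.1, t * z.2) y tz y2 e.
  by apply: (rk k); rewrite ke addrAC subrr add0r.
(* [(0, pi)] is a logarithm of [-1]. *)
exists (fun x => u x + (0, pi)).
  by move=> x; apply: cvgD; [exact: cu|exact: cvg_cst].
move=> x Ax; have := ue x Ax; have [y [z [y2 z2 yx fz rk]]] := rotf x Ax.
rewrite /K -fz !(contractE PP)// mul1r mul0r -surjective_pairing => ->.
rewrite (polar_radius0 PP).
rewrite cexpD cexp_pi -cmulA sub0r; congr cmul.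
by apply: pairE => /=; ring.
Qed.

End BoundaryLogarithm.

(** * The degree of regular approximations *)

Section RegularDegree.
Variable R : realType.
Implicit Types (g h : R * R -> R * R) (U : set (R * R)).

Lemma compact_isolated_finite (T : ptopologicalType) (A Z : set T) : compact A ->
  (forall a, A a -> \forall x \near a, A x -> Z x -> x = a) ->
  finite_set (A `&` Z).
Proof.
move=> + AZ; rewrite compact_cover => cA.
pose V (a : T) := [set x | A x -> Z x -> x = a]^°.
have [|x Ax|D _ AD] := cA T A V.
- by move=> a _; exact: open_interior.
- by exists x => //; exact: AZ.
apply: (finite_subfset D) => x [Ax Zx].
by have [a Da /nbhs_singleton /(_ Ax Zx) ->] := AD x Ax.
Qed.

Lemma simple_zero_isolated h a b : simple_zero h a b ->
  \forall x \near a, h x = 0 -> x = a.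
Proof.
move=> [p [c [p0 /andP[c0 c1] Hp]]]; apply: filterS Hp => x + hx.
rewrite hx sub0r cmodN cmodM cmod_cflip => H.
apply/eqP; rewrite -subr_eq0 -cmod_eq0; apply/eqP/le_anti.
rewrite cmod_ge0 andbT; rewrite -cmod_gt0 in p0.
have : (1 - c) * (cmod p * cmod (x - a)) <= 0 by lra.
rewrite pmulr_rle0 ?subr_gt0// pmulr_rle0//.
Qed.

Lemma regular_degree_boundary U g h v : open U -> bounded_set U -> U 0 ->
  {within closure U, continuous g} -> regular_approx g U 0 h ->
  {within boundary U, continuous v} ->
  (forall x, boundary U x -> g x = cmul (cexp (v x)) x) ->
  regular_degree h U 0 = 1.
Proof.
move=> oU bU U0 cg [ch C1h rh hg] cv gv.
have bcU : boundary U `<=` closure U by move=> x [].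
have hg' x : boundary U x -> `|h x - g x| < `|g x|.
  by move=> bx; have := hg x x (bcU x bx) bx; rewrite subr0.
have [u cu hu] := log_close (compact_boundary bU)
  (continuous_subspaceW bcU cg) (continuous_subspaceW bcU ch) hg'.
have hE x : boundary U x -> h x = cmul (cexp (u x + v x)) x.
  by move=> bx; rewrite hu// gv// cmulA -cexpD.
have h_bnd x : boundary U x -> h x <> 0.
  move=> bx hx; have := hg' x bx.
  by rewrite hx sub0r normrN ltxx.
have sz x : U x -> h x = 0 -> simple_zero h x (0 < jacobian_det h x).
  by move=> Ux hx; apply: simple_zero_differentiable => //; [have [] := C1h x Ux|exact: rh].
pose Z := U `&` h @^-1` [set 0].
have fZ : finite_set Z.
  apply: (@sub_finite_set _ _ (closure U `&` [set x | h x = 0])).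
    by move=> x [Ux hx]; split => //; exact: subset_closure.
  apply: (@compact_isolated_finite ((R * R)%type : normedModType R) (closure U)
    [set x | h x = 0]); first exact: compact_closure_bounded.
  move=> a cUa; have [ha|ha] := eqVneq (h a) 0.
    have Ua : U a.
      by apply: contrapT => nUa; apply: (h_bnd a) => //; exact: closure_open.
    apply: filterS (simple_zero_isolated (sz a Ua ha)) => x hx _; exact: hx.
  have ha0 : 0 < cmod (h a) by rewrite cmod_gt0.
  have cha := cvg_cmod ((subspace_continuousP _ _).1 ch a cUa).
  have H : \forall x \near a, closure U x -> 0 < cmod (h x).
    exact: (cvgr_gt _ (cha _) _ ha0).
  by apply: filterS H => x hx cx /= h0; have := hx cx; rewrite h0 cmod0 ltxx.
rewrite /regular_degree fsbig_finite//=.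
rewrite (eq_big_seq (fun x => csign (0 < jacobian_det h x))); last first.
  move=> x; rewrite in_fset_set// inE => -[Ux hx].
  have J0 := rh x Ux hx; rewrite /csign.
  have [J|J|J] := ltrgtP 0 (jacobian_det h x).
  - exact: gtr0_sgz.
  - exact: ltr0_sgz.
  - by rewrite -J eqxx in J0.
apply: (@sum_sign_boundary _ U h (fun x => u x + v x)) => //.
- by move=> x; apply: cvgD; [exact: cu|exact: cv].
- exact: finmap.fset_uniq.
- by move=> x; rewrite in_fset_set// inE.
- by move=> x; rewrite in_fset_set// inE => -[Ux hx]; exact: sz.
Qed.

(** Without zeros in [U], the sum in [sum_sign_boundary] would be empty. *)
Lemma zero_boundary U g v : open U -> bounded_set U -> U 0 ->
  {within closure U, continuous g} -> {within boundary U, continuous v} ->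
  (forall x, boundary U x -> g x = cmul (cexp (v x)) x) ->
  exists2 x, U x & g x = 0.
Proof.
move=> oU bU U0 cg cv gv; apply: contrapT => no0.
have no_zero x : U x /\ g x = 0 <-> x \in [::].
  by split=> [[Ux gx]|//]; exfalso; apply: no0; exists x.
have := @sum_sign_boundary _ U g v [::] (fun=> true) oU bU U0 cg cv gv isT no_zero.
have no_simple a : a \in [::] -> simple_zero g a true by [].
by rewrite big_nil => /(_ no_simple).
Qed.

End RegularDegree.

(** * Smooth interpolation on a grid *)

Section Smoothstep.
Variable R : realType.
Implicit Types (s t x y : R).

(** The cubic Hermite step from [0] to [1] on the unit interval. *)
Definition smoothstep t : R :=
  if t <= 0 then 0 else if 1 <= t then 1 else t ^+ 2 * (3 - 2 * t).

(** The derivative of [smoothstep]. *)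
Definition smoothstep' t : R :=
  if t <= 0 then 0 else if 1 <= t then 0 else 6 * t * (1 - t).

Lemma smoothstep_le0 t : t <= 0 -> smoothstep t = 0.
Proof. by rewrite /smoothstep => ->. Qed.

Lemma smoothstep_ge1 t : 1 <= t -> smoothstep t = 1.
Proof. by move=> t1; rewrite /smoothstep t1 leNgt (lt_le_trans ltr01 t1). Qed.

Lemma smoothstep'_le0 t : t <= 0 -> smoothstep' t = 0.
Proof. by rewrite /smoothstep' => ->. Qed.

Lemma smoothstep'_ge1 t : 1 <= t -> smoothstep' t = 0.
Proof. by move=> t1; rewrite /smoothstep' t1 if_same. Qed.

Lemma smoothstep_itv t : 0 <= smoothstep t <= 1.
Proof.
rewrite /smoothstep; case: ifPn => [_|]; first by rewrite lexx ler01.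
case: ifPn => [_ _|]; first by rewrite lexx ler01.
rewrite -!ltNge => t1 t0; apply/andP; split.
  by rewrite mulr_ge0 ?sqr_ge0//; lra.
have := mulr_ge0 (sqr_ge0 (1 - t)) (_ : 0 <= 1 + 2 * t).
by move=> /(_ ltac:(lra)); lra.
Qed.

Lemma smoothstep_nondegenerate t : smoothstep t != 0 -> smoothstep t != 1 ->
  smoothstep' t != 0.
Proof.
rewrite /smoothstep /smoothstep'; case: ifPn => [_|]; first by rewrite eqxx.
case: ifPn => [_ _ _|]; first by rewrite eqxx.
rewrite -!ltNge => t1 t0 _ _; rewrite gt_eqF//.
by rewrite !mulr_gt0// subr_gt0.
Qed.

(** Taylor's formula at order two, which covers the junctions at [0] and [1]. *)
Lemma smoothstep_quadratic x y :
  `|smoothstep y - smoothstep x - smoothstep' x * (y - x)| <= 3 * (y - x) ^+ 2.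
Proof.
(* The case of a point [z] of the unit interval and of a point at distance [d]
   of it on the other side of [0]. *)
have far (z d : R) : 0 < z < 1 -> z <= d ->
    `|z ^+ 2 * (3 - 2 * z) - 6 * z * (1 - z) * d| <= 3 * d ^+ 2.
  move=> /andP[z0 z1] zd; rewrite ler_norml; apply/andP; split.
    have h1 := sqr_ge0 (d - z * (1 - z)).
    have h2 : 0 <= z ^+ 3 * (4 - 3 * z) by rewrite mulr_ge0 ?exprn_ge0 ?ltW//; lra.
    by nra.
  have h1 : 0 <= (d - z) * (d + z) by rewrite mulr_ge0; lra.
  have h2 : 0 <= z * (1 - z) * d by rewrite !mulr_ge0; lra.
  have h3 : 0 <= z ^+ 3 by rewrite exprn_ge0// ltW.
  by nra.
have low (z d : R) : 0 <= z -> z <= d -> z ^+ 2 <= d ^+ 2 by move=> z0 zd; nra.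
rewrite /smoothstep /smoothstep'.
case: (leP x 0) => x0.
  rewrite subr0 mul0r subr0; case: (leP y 0) => y0.
    by rewrite normr0 mulr_ge0 ?sqr_ge0.
  have dy := low y (y - x) (ltW y0) ltac:(lra).
  case: (leP 1 y) => y1; first by rewrite normr1; nra.
  rewrite ger0_norm; last by rewrite mulr_ge0 ?sqr_ge0//; lra.
  have h : 0 <= y ^+ 3 by rewrite exprn_ge0// ltW.
  by nra.
case: (leP 1 x) => x1.
  rewrite mul0r subr0 distrC; case: (leP 1 y) => y1.
    have -> : (y <= 0) = false by apply/negbTE; rewrite -ltNge; lra.
    by rewrite subrr normr0 mulr_ge0 ?sqr_ge0.
  have dy := low (1 - y) (x - y) ltac:(lra) ltac:(lra).
  rewrite -[(y - x) ^+ 2]sqrrN opprB.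
  case: (leP y 0) => y0.
    by rewrite subr0 normr1; nra.
  have -> : 1 - y ^+ 2 * (3 - 2 * y) = (1 - y) ^+ 2 * (1 + 2 * y) by ring.
  rewrite ger0_norm; last by rewrite mulr_ge0 ?sqr_ge0//; lra.
  have h : 0 <= (1 - y) ^+ 3 by rewrite exprn_ge0//; lra.
  by nra.
case: (leP y 0) => y0.
  have := far x (x - y) ltac:(by rewrite x0 x1) ltac:(lra).
  rewrite -[(y - x) ^+ 2]sqrrN opprB -normrN.
  by congr (`|_| <= _); ring.
case: (leP 1 y) => y1.
  have := far (1 - x) (y - x) ltac:(by apply/andP; split; lra) ltac:(lra).
  by congr (`|_| <= _); ring.
have -> : y ^+ 2 * (3 - 2 * y) - x ^+ 2 * (3 - 2 * x) - 6 * x * (1 - x) * (y - x)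
  = (y - x) ^+ 2 * (3 - 2 * y - 4 * x) by ring.
rewrite normrM ger0_norm ?sqr_ge0// mulrC ler_wpM2r ?sqr_ge0// ler_norml.
by apply/andP; split; lra.
Qed.

End Smoothstep.

Section ContinuouslyDifferentiable.
Variable R : realType.
Implicit Types (F G : R * R -> R) (DF DG : R * R -> R * R -> R) (f : R -> R).

(** [F] is continuously differentiable on the plane, with differential [DF]. *)
Definition C1_with F DF : Prop :=
  (forall x, is_diff x F (DF x)) /\ forall v, continuous (DF ^~ v).

(** The quadratic bound makes [f'] Lipschitz continuous, as the roles of [x] and
    [y] can be exchanged. *)
Lemma quadratic_continuous (f f' : R -> R) (C : R) :
  (forall x y, `|f y - f x - f' x * (y - x)| <= C * (y - x) ^+ 2) ->
  continuous f'.
Proof.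
move=> quad.
have lip x y : `|f' y - f' x| <= 2 * C * `|y - x|.
  have [->|yx] := eqVneq y x; first by rewrite !subrr normr0 mulr0.
  have d0 : 0 < `|y - x| by rewrite normr_gt0 subr_eq0.
  rewrite -(ler_pM2r d0) -normrM -[leRHS]mulrA -expr2 real_normK ?num_real//.
  have := quad x y; have := quad y x; rewrite -[(x - y) ^+ 2]sqrrN opprB.
  move=> h1 h2; have := le_trans (ler_normD _ _) (lerD h1 h2).
  rewrite -mulrDl -mulr2n -mulr_natl.
  by congr (`|_| <= _); ring.
move=> x; apply/cvgrPdist_le => e e0.
have cv : 2 * C * `|y - x| @[y --> x] --> 2 * C * `|x - x|.
  apply: cvgM; first exact: cvg_cst.
  by apply: cvg_norm; apply: cvgB; [exact: cvg_id|exact: cvg_cst].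
have : \forall y \near x, 2 * C * `|y - x| <= e.
  by apply: cvgr_le cv _ _; rewrite subrr normr0 mulr0.
by apply: filterS => y; apply: le_trans; rewrite distrC.
Qed.

Lemma quadratic_is_diff (f f' : R -> R) (C : R) :
  (forall x y, `|f y - f x - f' x * (y - x)| <= C * (y - x) ^+ 2) ->
  forall x, is_diff x f (fun v => f' x * v).
Proof.
move=> quad x.
have lim : h^-1 *: ((f \o shift x) (h *: 1) - f x) @[h --> 0^'] --> f' x.
  apply/cvgrPdist_le => e e0.
  have cv : C * `|h| @[h --> (0 : R)^'] --> C * `|0 : R|.
    apply: cvgM; first exact: cvg_cst.
    by apply: cvg_norm; exact: cvg_within.
  have n1 : \forall h \near (0 : R)^', C * `|h| <= e.
    by apply: cvgr_le cv _ _; rewrite normr0 mulr0.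
  have n2 : \forall h \near (0 : R)^', h != 0 by exact: nbhs_dnbhs_neq.
  apply: filterS2 n1 n2 => h h1 h0; apply: le_trans h1.
  have hp : 0 < `|h| by rewrite normr_gt0.
  rewrite -(ler_pM2r hp) -normrM -[leRHS]mulrA -expr2 real_normK ?num_real//.
  have := quad x (h + x); rewrite addrK; congr (_ <= _).
  rewrite distrC /= -[_ *: 1]/(h * 1) mulr1 -[h^-1 *: _]/(h^-1 * _).
  by congr `|_|; field.
have df : derivable f x 1 by apply/cvg_ex; exists (f' x).
have D1 : 'D_1 f x = f' x by apply: cvg_lim.
apply: DiffDef; first exact/derivable1_diffP.
rewrite deriv1E//; apply/funext => v.
by rewrite derive1E D1 mulrC.
Qed.

Lemma C1_with_fst (f f' : R -> R) (C : R) :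
  (forall x y, `|f y - f x - f' x * (y - x)| <= C * (y - x) ^+ 2) ->
  C1_with (fun p => f p.1) (fun p v => f' p.1 * v.1).
Proof.
move=> quad; have c1 : continuous (@fst R R).
  by move=> p; have [] := (cvg_pairP _ p).1 (@cvg_id _ (nbhs p)).
split=> [x|v].
- have d1 : is_diff x (@fst R R) (@fst R R).
    by apply: DiffDef; [exact: linear_differentiable|rewrite diff_lin].
  have d2 := quadratic_is_diff quad x.1.
  exact: is_diff_comp.
- move=> x; apply: cvgM; last exact: cvg_cst.
  exact: (continuous_cvg _ (@quadratic_continuous f f' C quad x.1) (c1 x)).
Qed.

Lemma C1_with_snd (f f' : R -> R) (C : R) :
  (forall x y, `|f y - f x - f' x * (y - x)| <= C * (y - x) ^+ 2) ->
  C1_with (fun p => f p.2) (fun p v => f' p.2 * v.2).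
Proof.
move=> quad; have c2 : continuous (@snd R R).
  by move=> p; have [] := (cvg_pairP _ p).1 (@cvg_id _ (nbhs p)).
split=> [x|v].
- have d1 : is_diff x (@snd R R) (@snd R R).
    by apply: DiffDef; [exact: linear_differentiable|rewrite diff_lin].
  have d2 := quadratic_is_diff quad x.2.
  exact: is_diff_comp.
- move=> x; apply: cvgM; last exact: cvg_cst.
  exact: (continuous_cvg _ (@quadratic_continuous f f' C quad x.2) (c2 x)).
Qed.

Lemma C1_with_cst (c : R) : C1_with (fun=> c) (fun _ _ => 0).
Proof. by split=> [x|v x]; [exact: is_diff_cst|exact: cvg_cst]. Qed.

Lemma C1_with_continuous F DF : C1_with F DF -> continuous F.
Proof.
by move=> [dF _] x; apply: differentiable_continuous; have [] := dF x.
Qed.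

Lemma C1_withD F G DF DG : C1_with F DF -> C1_with G DG ->
  C1_with (fun x => F x + G x) (fun x v => DF x v + DG x v).
Proof.
move=> [dF cF] [dG cG]; split=> [x|v x]; last exact: cvgD (cF v x) (cG v x).
by have := is_diffD (dF x) (dG x).
Qed.

Lemma C1_withB F G DF DG : C1_with F DF -> C1_with G DG ->
  C1_with (fun x => F x - G x) (fun x v => DF x v - DG x v).
Proof.
move=> [dF cF] [dG cG]; split=> [x|v x]; last exact: cvgB (cF v x) (cG v x).
by have := is_diffB (dF x) (dG x).
Qed.

Lemma C1_withM F G DF DG : C1_with F DF -> C1_with G DG ->
  C1_with (fun x => F x * G x) (fun x v => DF x v * G x + F x * DG x v).
Proof.
move=> C1F C1G; have [dF cF] := C1F; have [dG cG] := C1G.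
split=> [x|v x].
  apply: (is_diff_eq (is_diffM (dF x) (dG x))).
  by apply/funext => v; rewrite addrC mulrC.
apply: cvgD; apply: cvgM.
- exact: cF.
- exact: (C1_with_continuous C1G).
- exact: (C1_with_continuous C1F).
- exact: cG.
Qed.

End ContinuouslyDifferentiable.

Section Interpolation.
Variable R : realType.

(** Interpolation of the values [a 0, ..., a N]: the value is [a m] when the
    first [m] weights are [1] and the next ones [0]. *)
Fixpoint interp (N : nat) (a w : nat -> R) : R :=
  if N is n.+1 then interp n a w + w n * (a n.+1 - a n) else a 0%N.

(** When all the weights but one are [0] or [1], only two consecutive values
    count. *)
Lemma interp_cell (N m : nat) (a w : nat -> R) : (m < N)%N ->
  (forall i, (i < m)%N -> w i = 1) -> (forall i, (m < i)%N -> w i = 0) ->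
  interp N a w = a m + w m * (a m.+1 - a m).
Proof.
move=> mN w1 w0; have lo n : (n <= m)%N -> interp n a w = a n.
  elim: n => // n IHn nm /=; by rewrite IHn ?(ltnW nm)// w1// mul1r addrC subrK.
elim: N mN => // N IHN; rewrite ltnS leq_eqVlt => /orP[/eqP <-|mN] /=.
  by rewrite lo.
by rewrite IHN// (w0 N)// mul0r addr0.
Qed.

(** The differential of an interpolation with varying values and weights. *)
Fixpoint Dinterp (N : nat) (a w da dw : nat -> R) : R :=
  if N is n.+1 then Dinterp n a w da dw +
    (dw n * (a n.+1 - a n) + w n * (da n.+1 - da n)) else da 0%N.

Lemma Dinterp_cell (N m : nat) (a w da dw : nat -> R) : (m < N)%N ->
  (forall i, (i < m)%N -> w i = 1) -> (forall i, (m < i)%N -> w i = 0) ->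
  (forall i, i != m -> dw i = 0) ->
  Dinterp N a w da dw =
    da m + (dw m * (a m.+1 - a m) + w m * (da m.+1 - da m)).
Proof.
move=> mN w1 w0 dw0; have lo n : (n <= m)%N -> Dinterp n a w da dw = da n.
  elim: n => // n IHn nm /=; rewrite IHn ?(ltnW nm)// w1// dw0 ?ltn_eqF//.
  by rewrite mul0r add0r mul1r addrC subrK.
elim: N mN => // N IHN; rewrite ltnS leq_eqVlt => /orP[/eqP <-|mN] /=.
  by rewrite lo.
by rewrite IHN// (w0 N)// (dw0 N) ?gtn_eqF// !mul0r !addr0.
Qed.

Lemma C1_with_interp (N : nat) (a w : nat -> R * R -> R)
    (da dw : nat -> R * R -> R * R -> R) :
  (forall i, C1_with (a i) (da i)) -> (forall i, C1_with (w i) (dw i)) ->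
  C1_with (fun x => interp N (a ^~ x) (w ^~ x))
    (fun x v => Dinterp N (a ^~ x) (w ^~ x) (fun i => da i x v) (fun i => dw i x v)).
Proof.
move=> aC wC; elim: N => [|N IHN] /=; first exact: aC.
by apply: C1_withD => //; apply: C1_withM => //; apply: C1_withB.
Qed.

End Interpolation.

(** * Critical values of bilinear maps *)

Section BilinearCriticalValues.
Variable R : realType.
Implicit Types (a b c d e u v w : R * R) (s t k : R) (q : (R * R) * (R * R) * (R * R)).

(** A polynomial map of degree at most one in each variable: the interpolation
    of values given at the four corners of a cell has this form. *)
Definition bilin a b c d s t : R * R := a + s *: b + t *: c + (s * t) *: d.

Definition cross u v : R := u.1 * v.2 - u.2 * v.1.

(** The point of parameter [s] of the curve with quadratic parametrisation
    [q]. *)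
Definition qcurve q s : R * R := q.1.1 + s *: q.1.2 + (s ^+ 2) *: q.2.

(** A curve through all the critical values of [bilin a b c d].  The Jacobian
    determinant is affine in [(s, t)], so its zeros form a line, unless they
    form the empty set or the whole plane; in the last case [b], [c] and [d] are
    parallel and the image is contained in a line. *)
Definition critical_curve a b c d : (R * R) * (R * R) * (R * R) :=
  let B := cross b c in let C := cross b d in let D := cross d c in
  if D != 0 then
    (a - (B / D) *: c, b - (C / D) *: c - (B / D) *: d, - (C / D) *: d)
  else if C != 0 then (a - (B / C) *: b, c - (B / C) *: d, 0)
  else (a, if b != 0 then b else if c != 0 then c else d, 0).

(** Curves through the critical values and through the images of the lines that
    bound the unit square. *)
Definition bad_curves a b c d : seq ((R * R) * (R * R) * (R * R)) :=
  [:: critical_curve a b c d; (a, c, 0); (a + b, c + d, 0); (a, b, 0);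
      (a + c, b + d, 0)].

Lemma scalep k u : k *: u = (k * u.1, k * u.2).
Proof. by []. Qed.

Lemma cross_parallel u v : u != 0 -> cross u v = 0 -> exists k, v = k *: u.
Proof.
move=> u0 uv; exists ((u.1 * v.1 + u.2 * v.2) / (u.1 ^+ 2 + u.2 ^+ 2)).
have n0 : u.1 ^+ 2 + u.2 ^+ 2 != 0 by move: u0; rewrite -csqn_eq0.
have e : u.1 * v.2 = u.2 * v.1 by apply/eqP; rewrite -subr_eq0; apply/eqP.
rewrite scalep; apply: pairE => /=; apply: (mulIf n0); rewrite mulrAC divfK//.
- by rewrite mulrDl mulrDr; ring: e.
- by rewrite mulrDl mulrDr; ring: e.
Qed.

Lemma critical_value a b c d s t :
  cross (b + t *: d) (c + s *: d) = 0 ->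
  exists k, bilin a b c d s t = qcurve (critical_curve a b c d) k.
Proof.
have -> : cross (b + t *: d) (c + s *: d) =
    cross b c + s * cross b d + t * cross d c.
  by rewrite /cross !scalep /=; ring.
rewrite /critical_curve => J.
have [D0|D0] := eqVneq (cross d c) 0; last first.
  exists s; have -> : t = - (cross b c + s * cross b d) / cross d c.
    by apply: (mulIf D0); rewrite divfK//; lra.
  by apply: pairE; rewrite /bilin /qcurve !scalep /=; field.
have [C0|C0] := eqVneq (cross b d) 0 => /=; last first.
  exists t; have -> : s = - (cross b c) / cross b d.
    by apply: (mulIf C0); rewrite divfK//; rewrite D0 in J; lra.
  by apply: pairE; rewrite /bilin /qcurve !scalep /=; field.
have B0 : cross b c = 0 by rewrite C0 D0 in J; lra.
have [b0|b0] := eqVneq b 0 => /=; last first.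
  have [k1 ->] := cross_parallel b0 B0; have [k2 ->] := cross_parallel b0 C0.
  exists (s + t * k1 + s * t * k2).
  by apply: pairE; rewrite /bilin /qcurve !scalep /=; ring.
have [c0|c0] := eqVneq c 0 => /=; last first.
  have C1 : cross c d = 0 by move: D0; rewrite /cross; lra.
  have [k2 ->] := cross_parallel c0 C1; rewrite b0.
  exists (t + s * t * k2).
  by apply: pairE; rewrite /bilin /qcurve !scalep /=; ring.
exists (s * t); rewrite b0 c0.
by apply: pairE; rewrite /bilin /qcurve !scalep /=; ring.
Qed.

Lemma bad_value a b c d s t :
  [\/ cross (b + t *: d) (c + s *: d) = 0, s = 0, s = 1 | t = 0 \/ t = 1] ->
  exists2 q, q \in bad_curves a b c d & exists k, bilin a b c d s t = qcurve q k.
Proof.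
move=> [/(critical_value a) h|->|->|[->|->]].
- by exists (critical_curve a b c d) => //; rewrite mem_head.
- exists (a, c, 0); first by rewrite !inE eqxx !orbT.
  by exists t; apply: pairE; rewrite /bilin /qcurve !scalep /=; ring.
- exists (a + b, c + d, 0); first by rewrite !inE eqxx !orbT.
  by exists t; apply: pairE; rewrite /bilin /qcurve !scalep /=; ring.
- exists (a, b, 0); first by rewrite !inE eqxx !orbT.
  by exists s; apply: pairE; rewrite /bilin /qcurve !scalep /=; ring.
- exists (a + c, b + d, 0); first by rewrite !inE eqxx !orbT.
  by exists s; apply: pairE; rewrite /bilin /qcurve !scalep /=; ring.
Qed.

Lemma small_notin (l : seq R) (r : R) : 0 < r -> exists2 x, 0 < x < r & x \notin l.
Proof.
move=> r0; suff [r' r'0 h] : exists2 r', 0 < r' <= r &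
    forall x, 0 < x < r' -> x \notin l.
  case/andP: r'0 => r'0 r'r; exists (r' / 2); last by apply: h; apply/andP; split; lra.
  by apply/andP; split; lra.
elim: l => [|y l [r' /andP[r'0 r'r] h]]; first by exists r; rewrite ?r0 ?lexx.
have [y0|y0] := ltP 0 y; last first.
  exists r'; first by rewrite r'0.
  move=> x xr; rewrite inE negb_or h// andbT.
  by apply/eqP => xy; move: xr; rewrite xy ltNge y0.
exists (Num.min r' y); first by rewrite lt_min r'0 y0 ge_min r'r.
move=> x /andP[x0]; rewrite lt_min => /andP[xr xy].
by rewrite inE negb_or h ?x0 ?xr// andbT lt_eqF.
Qed.

Lemma quadratic_roots (x0 x1 x2 : R) : (x0, x1, x2) != 0 ->
  exists l : seq R, forall s, x0 + s * x1 + s ^+ 2 * x2 = 0 -> s \in l.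
Proof.
move=> x_neq0.
have [[r rP]|no] := pselect (exists r, x0 + r * x1 + r ^+ 2 * x2 = 0); last first.
  by exists [::] => s sP; exfalso; apply: no; exists s.
exists [:: r; - x1 / x2 - r] => s sP; rewrite !inE.
have [//|sr] := eqVneq s r; apply/eqP.
have sr0 : s - r != 0 by rewrite subr_eq0.
have e : x1 + (s + r) * x2 = 0 by apply: (mulfI sr0); rewrite mulr0; lra.
have [x20|x20] := eqVneq x2 0; last by apply: (mulIf x20); rewrite mulrBl divfK//; lra.
have x10 : x1 = 0 by rewrite x20 in e; lra.
by move: x_neq0; rewrite (_ : x0 = 0) ?x10 ?x20 ?eqxx//; rewrite x10 x20 in rP; lra.
Qed.

(** Finitely many quadratic curves do not fill a neighbourhood of the origin:
    a generic line through the origin meets each of them finitely often. *)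
Lemma avoid_qcurves (l : seq ((R * R) * (R * R) * (R * R))) (r : R) : 0 < r ->
  exists2 w, `|w| < r & forall q s, q \in l -> w <> qcurve q s.
Proof.
move=> r0.
(* The direction [(1, k)] is not parallel to any nonzero coefficient of degree
   one or two of the curves. *)
have [k /andP[k0 k1] kl] := small_notin
  ([seq q.1.2.2 / q.1.2.1 | q <- l] ++ [seq q.2.2 / q.2.1 | q <- l]) ltr01.
have kP u : u.2 / u.1 != k -> u.2 - k * u.1 = 0 -> u = 0.
  move=> uk e; have [u1|u1] := eqVneq u.1 0.
    by apply: pairE => //=; rewrite u1 in e; lra.
  by move: uk; rewrite (_ : u.2 = k * u.1) ?mulfK ?eqxx//; lra.
have [bad badP] : exists bad : seq R,
    forall q s t, q \in l -> (t, t * k) = qcurve q s -> t \in bad.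
  elim: l kl => [|q l IHl] kl; first by exists [::].
  have [|bad badP] := IHl.
    move: kl; rewrite /= !(inE, mem_cat) !negb_or => /and4P[_ h1 _ h2].
    by rewrite h1 h2.
  have [k1q k2q] : q.1.2.2 / q.1.2.1 != k /\ q.2.2 / q.2.1 != k.
    move: kl; rewrite /= !(inE, mem_cat) !negb_or => /and4P[h1 _ h2 _].
    by split; rewrite eq_sym.
  suff [bq bqP] : exists bq : seq R,
      forall s t, (t, t * k) = qcurve q s -> t \in bq.
    exists (bq ++ bad) => p s t; rewrite inE mem_cat => /orP[/eqP ->|pl] tp.
      by rewrite (bqP s).
    by rewrite (badP p s) ?orbT.
  pose x0 := q.1.1.2 - k * q.1.1.1.
  pose x1 := q.1.2.2 - k * q.1.2.1.
  pose x2 := q.2.2 - k * q.2.1.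
  have [x_0|x_neq0] := eqVneq (x0, x1, x2) 0.
    have [_ e1 e2] := x_0; exists [:: q.1.1.1] => s t.
    rewrite /qcurve (kP _ k1q e1) (kP _ k2q e2) !scaler0 !addr0 => <-.
    by rewrite inE.
  have [rs rsP] := quadratic_roots x_neq0.
  exists [seq (qcurve q s).1 | s <- rs] => s t e.
  apply/mapP; exists s; last by rewrite -e.
  apply: rsP; have : t * k = (qcurve q s).2 by rewrite -e.
  have : t = (qcurve q s).1 by rewrite -e.
  rewrite /qcurve !scalep /= /x0 /x1 /x2 => -> e'.
  by rewrite !mulrBr; move: e'; lra.
have [t /andP[t0 tr] tbad] := small_notin bad r0.
exists (t, t * k).
  rewrite prod_normE /= gt_max !ger0_norm ?mulr_ge0 ?ltW// tr /=.
  by apply: le_lt_trans tr; rewrite ler_piMr// ltW.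
by move=> q s ql e; move: tbad; rewrite (badP q s t).
Qed.

End BilinearCriticalValues.

(** * Existence of regular approximations *)

Section GridInterpolation.
Variables (R : realType) (N : nat) (o step : R) (G : nat -> nat -> R * R).
Hypothesis step_gt0 : 0 < step.
Implicit Types (p : R * R -> R) (x v : R * R).

(** The smooth step from [0] to [1] between the grid coordinates [o + i * step]
    and [o + i.+1 * step], and its derivative. *)
Definition weight (i : nat) (t : R) : R := smoothstep ((t - o) / step - i%:R).

Definition weight' (i : nat) (t : R) : R :=
  smoothstep' ((t - o) / step - i%:R) / step.

Lemma weight_quadratic (i : nat) (x y : R) :
  `|weight i y - weight i x - weight' i x * (y - x)| <=
  3 / step ^+ 2 * (y - x) ^+ 2.
Proof.
have s0 : step != 0 by rewrite gt_eqF.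
have := smoothstep_quadratic ((x - o) / step - i%:R) ((y - o) / step - i%:R).
rewrite -/(weight i x) -/(weight i y) /weight'.
set S := smoothstep' _; set A := weight i y; set B := weight i x.
have -> : (y - o) / step - i%:R - ((x - o) / step - i%:R) = (y - x) / step.
  by field.
have -> : S / step * (y - x) = S * ((y - x) / step) by field.
by move/le_trans; apply; rewrite le_eqVlt; apply/orP; left; apply/eqP; field.
Qed.

(** The coordinate [p] of the map that interpolates the value [G i j] at the
    grid point [(o + i * step, o + j * step)], and its differential. *)
Definition gridc p x : R :=
  interp N (fun i => interp N (fun j => p (G i j)) (weight ^~ x.2)) (weight ^~ x.1).

Definition Dgridc p x v : R :=
  Dinterp N (fun i => interp N (fun j => p (G i j)) (weight ^~ x.2))
    (weight ^~ x.1)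
    (fun i => Dinterp N (fun j => p (G i j)) (weight ^~ x.2) (fun=> 0)
                (fun j => weight' j x.2 * v.2))
    (fun i => weight' i x.1 * v.1).

Lemma C1_gridc p : C1_with (gridc p) (Dgridc p).
Proof.
apply: (C1_with_interp N
  (a := fun i x => interp N (fun j => p (G i j)) (weight ^~ x.2))
  (w := fun i x => weight i x.1)
  (da := fun i x v => Dinterp N (fun j => p (G i j)) (weight ^~ x.2) (fun=> 0)
                (fun j => weight' j x.2 * v.2))
  (dw := fun i x v => weight' i x.1 * v.1)) => i; last first.
  exact: (C1_with_fst (weight_quadratic i)).
apply: (C1_with_interp N (a := fun j x => p (G i j))
  (w := fun j x => weight j x.2)
  (da := fun j x v => 0)
  (dw := fun j x v => weight' j x.2 * v.2)) => j; last first.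
  exact: (C1_with_snd (weight_quadratic j)).
exact: C1_with_cst.
Qed.

(** The formulas at a point [x] of the cell of indices [(m, n)]. *)
Section Cell.
Variables (m n : nat) (x : R * R).
Hypothesis mN : (m < N)%N.
Hypothesis nN : (n < N)%N.
Hypothesis xm : m%:R <= (x.1 - o) / step <= m.+1%:R.
Hypothesis xn : n%:R <= (x.2 - o) / step <= n.+1%:R.

Let a := G m n.
Let b := G m.+1 n - G m n.
Let c := G m n.+1 - G m n.
Let d := G m.+1 n.+1 - G m.+1 n - G m n.+1 + G m n.
Let s := weight m x.1.
Let t := weight n x.2.

Lemma weights_cell (k : nat) (y : R) : k%:R <= (y - o) / step <= k.+1%:R ->
  [/\ forall i, (i < k)%N -> weight i y = 1,
      forall i, (k < i)%N -> weight i y = 0 &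
      forall i, i != k -> weight' i y = 0].
Proof.
move=> /andP[ky yk].
have lo i : (i < k)%N -> 1 <= (y - o) / step - i%:R.
  by rewrite -(ler_nat R) -natr1 => ik; lra.
have hi i : (k < i)%N -> (y - o) / step - i%:R <= 0.
  by rewrite -(ler_nat R) => ik; lra.
split=> i.
- by move=> /lo; exact: smoothstep_ge1.
- by move=> /hi; exact: smoothstep_le0.
- rewrite neq_ltn /weight' => /orP[/lo|/hi] h.
    by rewrite smoothstep'_ge1// mul0r.
  by rewrite smoothstep'_le0// mul0r.
Qed.

Lemma gridc_cell p : gridc p x =
  p (G m n) + t * (p (G m n.+1) - p (G m n)) + s *
    ((p (G m.+1 n) + t * (p (G m.+1 n.+1) - p (G m.+1 n))) -
     (p (G m n) + t * (p (G m n.+1) - p (G m n)))).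
Proof.
have [w1 w0 _] := weights_cell xm; have [z1 z0 _] := weights_cell xn.
by rewrite /gridc (interp_cell _ mN)// !(interp_cell _ nN).
Qed.

Lemma Dgridc_cell p v : Dgridc p x v =
  weight' m x.1 * v.1 *
    ((p (G m.+1 n) + t * (p (G m.+1 n.+1) - p (G m.+1 n))) -
     (p (G m n) + t * (p (G m n.+1) - p (G m n)))) +
  weight' n x.2 * v.2 *
    (p (G m n.+1) - p (G m n) + s * (p (G m.+1 n.+1) - p (G m.+1 n) -
      (p (G m n.+1) - p (G m n)))).
Proof.
have [w1 w0 w'] := weights_cell xm; have [z1 z0 z'] := weights_cell xn.
rewrite /Dgridc (Dinterp_cell _ _ mN)//; last by move=> i im; rewrite w'// mul0r.
rewrite !(Dinterp_cell _ _ nN)// ?(interp_cell _ nN)//;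
  try by move=> i im; rewrite z'// mul0r.
by rewrite -/s -/t; ring.
Qed.

Lemma grid_cell : (gridc fst x, gridc snd x) = bilin a b c d s t.
Proof.
rewrite !gridc_cell /bilin !scalep /a /b /c /d.
by apply: pairE => /=; ring.
Qed.

Lemma grid_jacobian_cell :
  Dgridc fst x (1, 0) * Dgridc snd x (0, 1) -
  Dgridc fst x (0, 1) * Dgridc snd x (1, 0) =
  weight' m x.1 * weight' n x.2 * cross (b + t *: d) (c + s *: d).
Proof.
rewrite !Dgridc_cell /cross !scalep /b /c /d /=; ring.
Qed.

Lemma grid_close (y : R * R) (e : R) :
  (forall i j, (i = m \/ i = m.+1) -> (j = n \/ j = n.+1) -> `|G i j - y| <= e) ->
  `|(gridc fst x, gridc snd x) - y| <= e.
Proof.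
move=> Ge.
have mix (r : R) (u v z : R) : 0 <= r <= 1 -> `|u - z| <= e -> `|v - z| <= e ->
    `|u + r * (v - u) - z| <= e.
  move=> /andP[r0 r1] /ler_normlP[u1 u2] /ler_normlP[v1 v2].
  by rewrite ler_norml; apply/andP; split; nra.
have cell p (z : R) : (forall i j, (i = m \/ i = m.+1) -> (j = n \/ j = n.+1) ->
    `|p (G i j) - z| <= e) -> `|gridc p x - z| <= e.
  move=> pe; rewrite gridc_cell.
  apply: (mix); first exact: smoothstep_itv.
    by apply: (mix); [exact: smoothstep_itv| |]; apply: pe; auto.
  by apply: (mix); [exact: smoothstep_itv| |]; apply: pe; auto.
rewrite prod_normE ge_max; apply/andP; split => /=.
  apply: cell => i j hi hj; apply: le_trans (Ge i j hi hj).
  by rewrite prod_normE le_max lexx.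
apply: cell => i j hi hj; apply: le_trans (Ge i j hi hj).
by rewrite prod_normE le_max lexx orbT.
Qed.

End Cell.

End GridInterpolation.

Section RegularApproximation.
Variable R : realType.
Implicit Types (U A : set (R * R)) (g h : R * R -> R * R).

Lemma compact_uniform_continuity A g (e : R) : compact A -> continuous g ->
  0 < e -> exists2 r, 0 < r &
    forall x y, A x -> `|x - y| < r -> `|g x - g y| < e.
Proof.
move=> kA cg e0.
pose P (r : R) x := forall y, `|x - y| < r -> `|g x - g y| < e.
have ball_g (x : R * R) : exists2 r, 0 < r &
    forall y, `|x - y| < r -> `|g x - g y| < e / 2.
  have H : \forall z \near x, `|g x - g z| < e / 2.
    by move/cvgrPdist_lt : (cg x); apply; rewrite divr_gt0.
  have [r r0 rP] := (nbhs_normP _ _).1 H.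
  by exists r.
have H : \forall r \near (0 : R)^'+, A `<=` P r.
  apply: ((compact_near_coveringP A).1 kA R (nbhs (0 : R)^'+) P) => x Ax.
  have [r r0 rP] := ball_g x.
  have near_x : nbhs (x : R * R) [set y | `|x - y| < r / 2].
    by apply/(nbhs_normP (x : R * R)); exists (r / 2) => //=; rewrite divr_gt0.
  exists ([set y | `|x - y| < r / 2], [set t | t < r / 2]).
    split => /=.
      exact: near_x.
    by apply: nbhs_right_lt; rewrite divr_gt0.
  move=> [z t] /= [zx tr] y zy.
  have h1 : `|g x - g z| < e / 2 by apply: rP => /=; apply: lt_trans zx _; lra.
  have h2 : `|g x - g y| < e / 2.
    apply: rP => /=; have := ler_distD z x y; lra.
  by have := ler_distD (g x) (g z) (g y); rewrite [`|g z - g x|]distrC; lra.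
near (0 : R)^'+ => r; exists r; first by near: r; exact: nbhs_right_gt.
have AP : A `<=` P r by near: r.
by move=> x y /AP; exact.
Unshelve. all: by end_near. Qed.

Lemma unit_cell (N : nat) (u : R) : (0 < N)%N -> 0 <= u <= N%:R ->
  exists2 m, (m < N)%N & m%:R <= u <= m.+1%:R.
Proof.
elim: N => // N IHN _ /andP[u0 uN].
have [Nu|uN'] := leP N%:R u; first by exists N => //; rewrite Nu.
have N0 : (0 < N)%N by rewrite lt0n; apply: contraTneq uN' => ->; rewrite -leNgt.
have [|m mN mu] := IHN N0; first by rewrite u0 ltW.
by exists m => //; exact: ltnW.
Qed.

(** Every continuous map is uniformly approximated on a bounded set by a
    continuously differentiable map for which [0] is a regular value: the
    interpolation on a fine grid, translated by a small generic vector [c]. *)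
Lemma smooth_regular_map U g (M e : R) : 0 < M -> (forall x, U x -> `|x| <= M) ->
  continuous g -> 0 < e ->
  exists h, [/\ continuous h, C1_on U h, regular_value U h 0 &
    forall x, `|x| <= M -> `|h x - g x| < e].
Proof.
move=> M0 UM cg e0.
pose A := [set x : R * R | `|x| <= M].
have kA : compact A.
  apply: (@compact_plane _ A M) => //.
  apply: (@closed_comp _ _ (fun x : R * R => `|x|) [set t | t <= M]).
    by move=> y _; exact: norm_continuous.
  exact: closed_le.
have e2 : 0 < e / 2 by rewrite divr_gt0.
have [r r0 rP] := compact_uniform_continuity kA cg e2.
pose N := (Num.truncn (2 * M / r)).+1.
have NP : 2 * M / r < N%:R by exact: truncnS_gt.
pose st := 2 * M / N%:R.
have N0 : 0 < N%:R :> R by rewrite ltr0n.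
have st0 : 0 < st by rewrite divr_gt0// mulr_gt0.
have str : st < r by rewrite /st ltr_pdivrMr// [ltRHS]mulrC -ltr_pdivrMr.
have Nst : N%:R * st = 2 * M by rewrite mulrC /st divfK// gt_eqF.
pose X (i : nat) : R := - M + i%:R * st.
pose G i j := g (X i, X j).
pose cellc m n := bad_curves (G m n) (G m.+1 n - G m n) (G m n.+1 - G m n)
  (G m.+1 n.+1 - G m.+1 n - G m n.+1 + G m n).
pose l := flatten [seq cellc m n | m <- iota 0 N, n <- iota 0 N].
have [c ce cl] := avoid_qcurves l e2.
pose H p := gridc N (- M) st G p.
pose DH p := Dgridc N (- M) st G p.
have C1H p : C1_with (fun x => H p x - p c) (fun x v => DH p x v - 0).
  by apply: C1_withB; [exact: C1_gridc|exact: C1_with_cst].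
pose h x : R * R := (H fst x - c.1, H snd x - c.2).
have cell x : `|x| <= M -> exists m n, [/\ (m < N)%N, (n < N)%N,
    m%:R <= (x.1 - - M) / st <= m.+1%:R & n%:R <= (x.2 - - M) / st <= n.+1%:R].
  rewrite prod_normE ge_max => /andP[x1 x2].
  have itv (y : R) : `|y| <= M -> 0 <= (y - - M) / st <= N%:R.
    move=> /ler_normlP[y1 y2]; apply/andP; split.
      by apply: divr_ge0; [lra|exact: ltW].
    rewrite ler_pdivrMr// Nst; lra.
  have [m mN xm] := unit_cell (ltn0Sn _ : (0 < N)%N) (itv _ x1).
  have [n nN xn] := unit_cell (ltn0Sn _ : (0 < N)%N) (itv _ x2).
  by exists m, n.
have dh x : is_diff x h (fun v => (DH fst x v - 0, DH snd x v - 0)).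
  have [d1 _] := C1H fst; have [d2 _] := C1H snd.
  by have d1x := d1 x; have d2x := d2 x; exact: is_diff_pair.
have Dh x v : 'D_v h x = (DH fst x v, DH snd x v).
  have dhx := dh x; rewrite deriveE; last exact: ex_diff.
  by rewrite diff_val !subr0.
exists h; split.
- by move=> x; apply: differentiable_continuous; have [] := dh x.
- move=> x Ux; split; first by have [] := dh x.
  move=> v; rewrite (_ : (fun z => _) = fun z => (DH fst z v - 0, DH snd z v - 0)).
    apply/cvg_pairP; split.
      exact: (C1H fst).2.
    exact: (C1H snd).2.
  by apply/funext => z; rewrite Dh !subr0.
- move=> x Ux hx; have [m [n [mN nN xm xn]]] := cell x (UM x Ux).
  rewrite /jacobian_det !Dh /= (grid_jacobian_cell _ mN nN xm xn).
  have cE : (H fst x, H snd x) = c.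
    case: hx => h1 h2.
    by apply: pairE => /=; apply/eqP; rewrite -subr_eq0; apply/eqP.
  (* The value [c] is not critical in the cell, and the point [x] is not on the
     sides of the cell, where the derivatives of the weights vanish. *)
  have good : ~ [\/ cross (G m.+1 n - G m n + weight (- M) st n x.2 *:
                  (G m.+1 n.+1 - G m.+1 n - G m n.+1 + G m n))
              (G m n.+1 - G m n + weight (- M) st m x.1 *:
                  (G m.+1 n.+1 - G m.+1 n - G m n.+1 + G m n)) = 0,
             weight (- M) st m x.1 = 0, weight (- M) st m x.1 = 1 |
             weight (- M) st n x.2 = 0 \/ weight (- M) st n x.2 = 1].
    move=> /(bad_value (G m n))[q ql [k qk]].
    apply: (cl q k); last by rewrite -qk -(grid_cell G mN nN xm xn) -cE.
    apply/flattenP; exists (cellc m n) => //.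
    by apply: allpairs_f; rewrite mem_iota.
  have st_neq0 : st^-1 != 0 by rewrite invr_eq0 gt_eqF.
  rewrite !mulf_neq0//.
  + apply: smoothstep_nondegenerate; apply/eqP => p; apply: good.
      exact: Or42.
    exact: Or43.
  + apply: smoothstep_nondegenerate; apply/eqP => p; apply: good; apply: Or44.
      by left.
    by right.
  + by apply/eqP => p; apply: good; exact: Or41.
- move=> x xM; have [m [n [mN nN xm xn]]] := cell x xM.
  have X_close (k i : nat) (y : R) : k%:R <= (y - - M) / st <= k.+1%:R ->
      i = k \/ i = k.+1 -> `|y - X i| < r.
    rewrite ler_pdivlMr// ler_pdivrMr// => /andP[]; rewrite -[k.+1%:R]natr1 => k1 k2 ik.
    apply: le_lt_trans str; rewrite /X ler_norml.
    by case: ik => ->; rewrite -?[k.+1%:R]natr1; apply/andP; split; lra.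
  have -> : h x - g x = (H fst x, H snd x) - g x - c.
    by rewrite /h; apply: pairE => /=; ring.
  apply: le_lt_trans (ler_normB _ _) _.
  suff : `|(H fst x, H snd x) - g x| <= e / 2 by lra.
  apply: (grid_close mN nN xm xn) => i j im jn.
  rewrite distrC; apply/ltW/rP => //.
  by rewrite prod_normE gt_max /= (X_close m i) ?(X_close n j).
Qed.

End RegularApproximation.

(** * The degree of a map whose rotation numbers avoid the integers *)

Section DegreeOne.
Variable R : realType.
Implicit Types (U : set (R * R)) (g : R * R -> R * R).

Lemma regular_approx_exists U g : open U -> bounded_set U ->
  {within closure U, continuous g} -> (forall x, boundary U x -> g x != 0) ->
  exists h, regular_approx g U 0 h.
Proof.
move=> oU bU cg g0.
have [e e0 eg] : exists2 e, 0 < e & forall z, boundary U z -> e <= `|g z|.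
  have [b0|bN0] := pselect (boundary U !=set0); last first.
    by exists 1 => // z bz; exfalso; apply: bN0; exists z.
  have cbg : {within boundary U, continuous (fun z => `|g z|)}.
    have bcU : boundary U `<=` closure U by move=> x [].
    by move=> z; apply: cvg_norm; exact: (continuous_subspaceW bcU cg).
  have [z zb zmin] := compact_EVT_min b0 (compact_boundary bU) cbg.
  exists `|g z|; first by rewrite normr_gt0 g0//; move: zb; rewrite inE.
  by move=> x bx; apply: zmin; rewrite inE.
have [G cG Gg] := continuous_extension_plane (compact_closure_bounded bU)
  (@closed_closure _ U) cg.
have [M M0 UM] := bounded_closure bU.
have UM' x : U x -> `|x| <= M by move=> Ux; apply: UM; exact: subset_closure.
have [h [ch C1h rh hG]] := smooth_regular_map M0 UM' cG e0.
exists h; split => //; first exact: continuous_subspaceT.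
move=> x z cx bz; rewrite subr0 -Gg//.
by apply: lt_le_trans (eg z bz); apply: hG; exact: UM.
Qed.

(** The degree only depends on the homotopy class on the boundary, here that of
    the identity. *)
Lemma brouwer_degree_boundary U g v : open U -> bounded_set U -> U 0 ->
  {within closure U, continuous g} -> {within boundary U, continuous v} ->
  (forall x, boundary U x -> g x = cmul (cexp (v x)) x) ->
  brouwer_degree g U 0 = 1.
Proof.
move=> oU bU U0 cg cv gv.
have deg1 h : regular_approx g U 0 h -> regular_degree h U 0 = 1.
  by move=> gh; exact: (regular_degree_boundary oU bU U0 cg gh cv gv).
have [|h gh] := regular_approx_exists oU bU cg.
  move=> x bx; rewrite gv//; apply: cmul_neq0; first exact: cexp_neq0.
  have [_ nUx] := boundary_open oU bx.
  by apply/eqP => x0; apply: nUx; rewrite x0.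
apply: xget_unique; first by split; [exists h|exact: deg1].
by move=> d [_ dP]; rewrite -(dP h gh) deg1.
Qed.

Lemma Sigma_empty_rot (Psi F : R * R -> R * R) (E : set (R * R)) x (k : int) :
  Sigma Psi F E = set0 -> E x -> Defs.rot Psi F x <> k%:~R.
Proof.
move=> S0 Ex rk; have : Sigma Psi F E k.
  by rewrite /Sigma /= -rk; apply: sub_gen_smallest; exists x.
by rewrite S0.
Qed.

End DegreeOne.

Theorem theorem4p1 (R : realType) (Psi : R * R -> R * R) (T : R)
    (U : set (R * R)) (phi Phi : R -> R * R -> R * R)
    (Psi_polar : polar_like Psi)
    (T_gt0 : 0 < T)
    (U_open : open U) (U_bounded : bounded_set U) (U_zero : U 0)
    (phi_continuous : {within `[0, T] `*` closure U,
       continuous (fun p : R * (R * R) => phi p.1 p.2)})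
    (phi_id : forall x, closure U x -> phi 0 x = x)
    (phi_neq0 : forall t x, 0 <= t <= T -> boundary U x -> phi t x <> 0)
    (Phi_lift : is_lift Psi T (boundary U) phi Phi)
    (Sigma_empty : Sigma Psi (fun y => Phi T y - y) (boundary U) = set0) :
  brouwer_degree (fun x => phi T x - x) U 0 = 1 /\
  exists x, U x /\ phi T x = x.
Proof.
have TT : 0 <= T <= T by rewrite ltW/=.
have cT : {within closure U, continuous (phi T)}.
  by apply: within_slice phi_continuous; rewrite /= in_itv.
have bcU : boundary U `<=` closure U by move=> x [].
have [_ Phi_half _ Phi_phi] := Phi_lift.
have [|v cv fv] := log_sub_id (compact_boundary U_bounded) Psi_polar
    (continuous_subspaceW bcU cT).
  move=> x bx; have [_ nUx] := boundary_open U_open bx.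
  have x0 : x != 0 by apply/eqP => x0; apply: nUx; rewrite x0.
  have [y2 yx] := polar_get Psi_polar x0.
  set y := get _ in y2 yx *.
  have py : polar_preimage Psi (boundary U) y.
    by split; [exact: ltW|rewrite /= yx].
  exists y, (Phi T y); split => //; [exact: Phi_half|by rewrite Phi_phi// yx|].
  move=> k yk; apply: (Sigma_empty_rot (k := k) Sigma_empty bx).
  have p0 : 2 * pi != 0 :> R by rewrite mulf_neq0 ?pnatr_eq0// gt_eqF// pi_gt0.
  by rewrite /Defs.rot -/y /= yk mulrC mulKf.
have cf : {within closure U, continuous (fun x => phi T x - x)}.
  move=> x; apply: cvgB; first exact: cT.
  exact: (continuous_subspaceT (fun x => @cvg_id _ (nbhs x))).
split; first exact: brouwer_degree_boundary cv fv.
have [x Ux fx] := zero_boundary U_open U_bounded U_zero cf cv fv.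
by exists x; split => //; apply/eqP; rewrite -subr_eq0; apply/eqP.
Qed.
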